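(* 1. The 2-category $\mathrm{2Hilb}$ of 2-Hilbert spaces comes equipped with a canonical even-handed structure $\Psi$ (the one arising from the canonical traces $\mathrm{Tr}(f)=(\mathrm{id},f)$ on 2-Hilbert spaces). 2. $\Psi$ can be expressed in terms of the $*$-structure on the hom-sets and the inner products as $$\Psi(\varphi)=*\,\varphi^\star\,*,$$ i.e. $\Psi(\varphi)(g)=(\varphi^\star(g^* ))^*$, where $\varphi:\mathrm{Hom}(Fx,y)\to\mathrm{Hom}(x,F^*y)$ are adjunction isomorphisms and $\varphi^\star$ is the Hilbert space adjoint of $\varphi$.
   Context: Inner products are linear in the second variable. **2-Hilbert spaces.** An $H^*$-category is a category enriched in finite-dimensional complex Hilbert spaces (with linear maps), with antilinear maps $*:\mathrm{Hom}(x,y)\to\mathrm{Hom}(y,x)$ such that $f^{**}=f$, $(fg)^*=g^*f^*$, $(fg,h)=(g,f^*h)$, $(fg,h)=(f,hg^* )$ whenever defined. A 2-Hilbert space is a Cauchy complete $H^*$-category (equivalently: finite direct sums exist and idempotents split); it is semisimple. $\mathrm{2Hilb}$ has finite-dimensional 2-Hilbert spaces (finitely many isomorphism classes of simples) as objects, linear $*$-functors (linear on hom-sets, $F(f^* )=F(f)^*$) as morphisms, natural transformations as 2-morphisms. **Structure from traces.** The traces $\mathrm{Tr}_x(f)=(\mathrm{id}_x,f)$ give isomorphisms $s:\mathrm{Hom}(x,y)\to\mathrm{Hom}(y,x)^\vee$, $f\mapsto(g\mapsto\mathrm{Tr}_x(gf))$. For $F:A\to B$ with right adjoint $F^*$ and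 adjunction isomorphisms $\varphi$, the structure arising from the traces is $\Psi(\varphi)=\varphi^t=s_B^{-1}\circ\varphi^\vee\circ s_A:\mathrm{Hom}(F^*y,x)\to\mathrm{Hom}(y,Fx)$. **Even-handed structure.** In a 2-category, for $F:A\to B$ with right adjoint $F^*$, let $\mathrm{Adj}(F\dashv F^* )$ be the set of pairs $(\eta:\mathrm{id}_A\Rightarrow F^*F,\ \epsilon:FF^*\Rightarrow\mathrm{id}_B)$ satisfying the triangle identities. The 2-category has ambidextrous adjoints if every 1-morphism has an adjoint and all adjoints are two-sided. An even-handed structure on such a 2-category consists of a map $\Psi:\mathrm{Adj}(F\dashv F^* )\to\mathrm{Adj}(F^*\dashv F)$ for each pair of adjoint 1-morphisms such that (i) $\Psi^2=\mathrm{id}$; (ii) $\Psi$ sends the composite adjunction $GF\dashv F^*G^*$ of two adjunctions to the composite of their images under $\Psi$, and fixes the trivial adjunction on each identity morphism; (iii) for every $\theta:F\Rightarrow G$ and all choices of right adjoints, $(F^*\epsilon_G)\circ(F^*\theta G^* )\circ(\eta_FG^* )=(\epsilon'_GF^* )\circ(G^*\theta F^* )\circ(G^*\eta'_F):G^*\Rightarrow F^*$, where $(\eta'_F,\epsilon'_F)=\Psi(\eta_F,\epsilon_F)$ and $(\eta'_G,\epsilon'_G)=\Psi(\eta_G,\epsilon_G)$. Elements of $\mathrm{Adj}(F\dashv F^* )$ are identified with natural adjunction isomorphisms $\varphi:\mathrm{Hom}(Fx,y)\to\mathrm{Hom}(x,F^*y)$ by $\varphi(f)=F^*(f)\circ\eta_x$,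 $\varphi^{-1}(g)=\epsilon_y\circ F(g)$. *)

(* Defs.v *)
From HB Require Import structures.
From mathcomp Require Import all_boot all_order all_algebra.
From mathcomp Require Import sesquilinear boolp classical_sets.

Set Implicit Arguments.
Unset Strict Implicit.
Unset Printing Implicit Defensive.

Import GRing.Theory Num.Theory.

(* A strict 2-category is a bicategory whose constraint cells are identities.
   [comp1 G F] is G after F, [comp2 b a] is b after a. *)
Record bicategory := Bicategory {
  ob0 :> Type;
  ob1 : ob0 -> ob0 -> Type;
  ob2 : forall A B : ob0, ob1 A B -> ob1 A B -> Type;
  id1 : forall A, ob1 A A;
  comp1 : forall A B C, ob1 B C -> ob1 A B -> ob1 A C;
  id2 : forall A B (F : ob1 A B), ob2 F F;
  comp2 : forall A B (F G H : ob1 A B), ob2 G H -> ob2 F G -> ob2 F H;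
  lwhisk : forall A B C (G : ob1 B C) (F F' : ob1 A B),
    ob2 F F' -> ob2 (comp1 G F) (comp1 G F');
  rwhisk : forall A B C (G G' : ob1 B C) (F : ob1 A B),
    ob2 G G' -> ob2 (comp1 G F) (comp1 G' F);
  assoc : forall A B C D (H : ob1 C D) (G : ob1 B C) (F : ob1 A B),
    ob2 (comp1 (comp1 H G) F) (comp1 H (comp1 G F));
  associ : forall A B C D (H : ob1 C D) (G : ob1 B C) (F : ob1 A B),
    ob2 (comp1 H (comp1 G F)) (comp1 (comp1 H G) F);
  lunit : forall A B (F : ob1 A B), ob2 (comp1 (id1 B) F) F;
  luniti : forall A B (F : ob1 A B), ob2 F (comp1 (id1 B) F);
  runit : forall A B (F : ob1 A B), ob2 (comp1 F (id1 A)) F;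
  runiti : forall A B (F : ob1 A B), ob2 F (comp1 F (id1 A));
  comp2A : forall A B (F G H K : ob1 A B)
      (c : ob2 H K) (b : ob2 G H) (a : ob2 F G),
    comp2 c (comp2 b a) = comp2 (comp2 c b) a;
  comp2_id_l : forall A B (F G : ob1 A B) (a : ob2 F G), comp2 (id2 G) a = a;
  comp2_id_r : forall A B (F G : ob1 A B) (a : ob2 F G), comp2 a (id2 F) = a;
  lwhisk_id : forall A B C (G : ob1 B C) (F : ob1 A B),
    lwhisk G (id2 F) = id2 (comp1 G F);
  lwhisk_comp : forall A B C (G : ob1 B C) (F F' F'' : ob1 A B)
      (b : ob2 F' F'') (a : ob2 F F'),
    lwhisk G (comp2 b a) = comp2 (lwhisk G b) (lwhisk G a);
  rwhisk_id : forall A B C (G : ob1 B C) (F : ob1 A B),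
    rwhisk F (id2 G) = id2 (comp1 G F);
  rwhisk_comp : forall A B C (G G' G'' : ob1 B C) (F : ob1 A B)
      (b : ob2 G' G'') (a : ob2 G G'),
    rwhisk F (comp2 b a) = comp2 (rwhisk F b) (rwhisk F a);
  interchange : forall A B C (G G' : ob1 B C) (F F' : ob1 A B)
      (b : ob2 G G') (a : ob2 F F'),
    comp2 (rwhisk F' b) (lwhisk G a) = comp2 (lwhisk G' a) (rwhisk F b);
  assocK : forall A B C D (H : ob1 C D) (G : ob1 B C) (F : ob1 A B),
    comp2 (associ H G F) (assoc H G F) = id2 _;
  associK : forall A B C D (H : ob1 C D) (G : ob1 B C) (F : ob1 A B),
    comp2 (assoc H G F) (associ H G F) = id2 _;
  lunitK : forall A B (F : ob1 A B), comp2 (luniti F) (lunit F) = id2 _;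
  lunitiK : forall A B (F : ob1 A B), comp2 (lunit F) (luniti F) = id2 _;
  runitK : forall A B (F : ob1 A B), comp2 (runiti F) (runit F) = id2 _;
  runitiK : forall A B (F : ob1 A B), comp2 (runit F) (runiti F) = id2 _;
  lunit_nat : forall A B (F G : ob1 A B) (a : ob2 F G),
    comp2 (lunit G) (lwhisk (id1 B) a) = comp2 a (lunit F);
  runit_nat : forall A B (F G : ob1 A B) (a : ob2 F G),
    comp2 (runit G) (rwhisk (id1 A) a) = comp2 a (runit F);
  assoc_nat_r : forall A B C D (H : ob1 C D) (G : ob1 B C) (F F' : ob1 A B)
      (a : ob2 F F'),
    comp2 (assoc H G F') (lwhisk (comp1 H G) a) =
    comp2 (lwhisk H (lwhisk G a)) (assoc H G F);
  assoc_nat_m : forall A B C D (H : ob1 C D) (G G' : ob1 B C) (F : ob1 A B)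
      (b : ob2 G G'),
    comp2 (assoc H G' F) (rwhisk F (lwhisk H b)) =
    comp2 (lwhisk H (rwhisk F b)) (assoc H G F);
  assoc_nat_l : forall A B C D (H H' : ob1 C D) (G : ob1 B C) (F : ob1 A B)
      (c : ob2 H H'),
    comp2 (assoc H' G F) (rwhisk F (rwhisk G c)) =
    comp2 (rwhisk (comp1 G F) c) (assoc H G F);
  pentagon : forall A B C D E (K : ob1 D E) (H : ob1 C D) (G : ob1 B C)
      (F : ob1 A B),
    comp2 (lwhisk K (assoc H G F))
      (comp2 (assoc K (comp1 H G) F) (rwhisk F (assoc K H G))) =
    comp2 (assoc K H (comp1 G F)) (assoc (comp1 K H) G F);
  triangle : forall A B C (G : ob1 B C) (F : ob1 A B),
    comp2 (lwhisk G (lunit F)) (assoc G (id1 B) F) = rwhisk F (runit G)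
}.

Declare Scope bicat_scope.
Delimit Scope bicat_scope with bicat.
Local Open Scope bicat_scope.
Arguments comp1 {_ A B C}.
Arguments id2 {_ A B}.
Arguments comp2 {_ A B F G H}.
Arguments lwhisk {_ A B C} G {F F'}.
Arguments rwhisk {_ A B C G G'} F.
Arguments assoc {_ A B C D}.
Arguments associ {_ A B C D}.
Arguments lunit {_ A B}.
Arguments luniti {_ A B}.
Arguments runit {_ A B}.
Arguments runiti {_ A B}.
Arguments id1 {_}.
Notation "G \o1 F" := (comp1 G F) (at level 40, left associativity) : bicat_scope.
Notation "b \o2 a" := (comp2 b a) (at level 50, left associativity) : bicat_scope.
Notation "G ◁ a" := (lwhisk G a) (at level 35, right associativity) : bicat_scope.
Notation "a ▷ F" := (rwhisk F a) (at level 39, left associativity) : bicat_scope.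

Section BicategoryTheory.
Variable K : bicategory.

Lemma lwhisk_id_inj (A B : K) (F G : ob1 A B) (a b : ob2 F G) :
  id1 B ◁ a = id1 B ◁ b -> a = b.
Proof.
move=> e; rewrite -[a]comp2_id_r -[b]comp2_id_r -(lunitiK F) !comp2A.
by rewrite -!lunit_nat e.
Qed.

Lemma rwhisk_id_inj (A B : K) (F G : ob1 A B) (a b : ob2 F G) :
  a ▷ id1 A = b ▷ id1 A -> a = b.
Proof.
move=> e; rewrite -[a]comp2_id_r -[b]comp2_id_r -(runitiK F) !comp2A.
by rewrite -!runit_nat e.
Qed.

Definition inv2 (A B : K) (F G : ob1 A B) (a : ob2 F G) (b : ob2 G F) :=
  b \o2 a = id2 _ /\ a \o2 b = id2 _.

Lemma inv2_l A B (F G : ob1 A B) (a : ob2 F G) (b : ob2 G F) : inv2 a b ->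
  forall (H : ob1 A B) (x : ob2 H F) (y : ob2 H G), (a \o2 x = y) <-> (x = b \o2 y).
Proof.
case=> ba ab H x y; split=> [<-|->]; first by rewrite comp2A ba comp2_id_l.
by rewrite comp2A ab comp2_id_l.
Qed.

Lemma inv2_r A B (F G : ob1 A B) (a : ob2 F G) (b : ob2 G F) : inv2 a b ->
  forall (H : ob1 A B) (x : ob2 G H) (y : ob2 F H), (x \o2 a = y) <-> (x = y \o2 b).
Proof.
case=> ba ab H x y; split=> [<-|->]; first by rewrite -comp2A ab comp2_id_r.
by rewrite -comp2A ba comp2_id_r.
Qed.

Lemma inv2_sym A B (F G : ob1 A B) (a : ob2 F G) (b : ob2 G F) :
  inv2 a b -> inv2 b a.
Proof. by case. Qed.
Lemma inv2_assoc (A B C D : K) (H : ob1 C D) (G : ob1 B C) (F : ob1 A B) :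
  inv2 (assoc H G F) (associ H G F).
Proof. by split; rewrite ?assocK ?associK. Qed.
Lemma inv2_lunit (A B : K) (F : ob1 A B) : inv2 (lunit F) (luniti F).
Proof. by split; rewrite ?lunitK ?lunitiK. Qed.
Lemma inv2_runit (A B : K) (F : ob1 A B) : inv2 (runit F) (runiti F).
Proof. by split; rewrite ?runitK ?runitiK. Qed.
Lemma inv2_lwhisk (A B C : K) (H : ob1 B C) (F G : ob1 A B) (a : ob2 F G) b :
  inv2 a b -> inv2 (H ◁ a) (H ◁ b).
Proof. by case=> ba ab; split; rewrite -lwhisk_comp ?ba ?ab lwhisk_id. Qed.
Lemma inv2_rwhisk (A B C : K) (H : ob1 A B) (F G : ob1 B C) (a : ob2 F G) b :
  inv2 a b -> inv2 (a ▷ H) (b ▷ H).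
Proof. by case=> ba ab; split; rewrite -rwhisk_comp ?ba ?ab rwhisk_id. Qed.

Lemma lunit_comp (A B C : K) (G : ob1 B C) (F : ob1 A B) :
  lunit (G \o1 F) \o2 assoc (id1 C) G F = lunit G ▷ F.
Proof.
apply: lwhisk_id_inj; rewrite lwhisk_comp.
set L := LHS; set R := RHS.
suff: L \o2 (assoc (id1 C) (id1 C \o1 G) F \o2 (assoc (id1 C) (id1 C) G ▷ F))
    = R \o2 (assoc (id1 C) (id1 C \o1 G) F \o2 (assoc (id1 C) (id1 C) G ▷ F)).
  rewrite !comp2A.
  move/(inv2_r (inv2_rwhisk F (inv2_assoc _ _ _))).
  rewrite -comp2A -rwhisk_comp associK rwhisk_id comp2_id_r.
  by move/(inv2_r (inv2_assoc _ _ _)); rewrite -comp2A associK comp2_id_r.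
rewrite /L /R -comp2A pentagon comp2A triangle comp2A -assoc_nat_m -comp2A.
by rewrite -rwhisk_comp triangle assoc_nat_l.
Qed.


Lemma comp2r (A B : K) (F G H I : ob1 A B) (b : ob2 G H) (a : ob2 F G)
    (c : ob2 F H) : b \o2 a = c -> forall d : ob2 H I, d \o2 b \o2 a = d \o2 c.
Proof. by move=> <- d; rewrite comp2A. Qed.

Lemma runit_comp (A B C : K) (G : ob1 B C) (F : ob1 A B) :
  G ◁ runit F \o2 assoc G F (id1 A) = runit (G \o1 F).
Proof.
apply: rwhisk_id_inj; rewrite rwhisk_comp -[RHS]triangle.
have e : assoc G F (id1 A) \o2 (G ◁ runit F \o2 assoc G F (id1 A)) ▷ id1 A
  = assoc G F (id1 A) \o2 ((G \o1 F) ◁ lunit (id1 A) \o2 assoc (G \o1 F) (id1 A) (id1 A)).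
  rewrite rwhisk_comp comp2A assoc_nat_m -triangle lwhisk_comp -!comp2A pentagon.
  by rewrite !comp2A assoc_nat_r.
move: e; rewrite rwhisk_comp => /(inv2_l (inv2_assoc _ _ _)) ->.
by rewrite comp2A assocK comp2_id_l.
Qed.

Lemma lunit_id (A : K) : lunit (id1 A) = runit (id1 A).
Proof.
apply: rwhisk_id_inj; rewrite -lunit_comp -triangle; congr (_ \o2 _).
have := lunit_nat (lunit (id1 A)) => /(inv2_l (inv2_lunit _)) ->.
by rewrite comp2A lunitK comp2_id_l.
Qed.

Lemma triangle_inv (A B C : K) (G : ob1 B C) (F : ob1 A B) :
  assoc G (id1 B) F \o2 runiti G ▷ F = G ◁ luniti F.
Proof.
have/(inv2_l (inv2_lwhisk _ (inv2_lunit _))) -> := triangle G F.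
by rewrite -comp2A -rwhisk_comp runitiK rwhisk_id comp2_id_r.
Qed.

Lemma lunit_comp_inv (A B C : K) (G : ob1 B C) (F : ob1 A B) :
  assoc (id1 C) G F \o2 luniti G ▷ F = luniti (G \o1 F).
Proof.
have/(inv2_l (inv2_lunit _)) -> := lunit_comp G F.
by rewrite -comp2A -rwhisk_comp lunitiK rwhisk_id comp2_id_r.
Qed.

Section Insert.
Variables (A B : K) (F : ob1 A B) (U : ob1 B A).
Variables (eta : ob2 (id1 A) (U \o1 F)) (eps : ob2 (F \o1 U) (id1 B)).

(* the triangle identities, F = F id -> F (U F) -> (F U) F -> id F = F and
   U = id U -> (U F) U -> U (F U) -> U id = U *)
Definition adj_tri1 : Prop :=
  lunit F \o2 (eps ▷ F \o2 (associ F U F \o2 (F ◁ eta \o2 runiti F)))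
  = id2 F.
Definition adj_tri2 : Prop :=
  runit U \o2 (U ◁ eps \o2 (assoc U F U \o2 (eta ▷ U \o2 luniti U)))
  = id2 U.

(* Y -> id Y -> (U F) Y -> U (F Y) and F (U Y) -> (F U) Y -> id Y -> Y *)
Definition ins_unit (X : K) (Y : ob1 X A) : ob2 Y (U \o1 (F \o1 Y)) :=
  assoc U F Y \o2 (eta ▷ Y \o2 luniti Y).
Definition ins_counit (X : K) (Y : ob1 X B) : ob2 (F \o1 (U \o1 Y)) Y :=
  lunit Y \o2 (eps ▷ Y \o2 associ F U Y).

Lemma luniti_nat (X Y : K) (P Q : ob1 X Y) (a : ob2 P Q) :
  luniti Q \o2 a = id1 Y ◁ a \o2 luniti P.
Proof.
apply/esym/(inv2_l (inv2_lunit _)).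
by rewrite comp2A lunit_nat -comp2A lunitiK comp2_id_r.
Qed.
Lemma associ_nat_r W X Y Z (H : ob1 Y Z) (G : ob1 X Y) (P P' : ob1 W X)
      (a : @ob2 K _ _ P P') :
  associ H G P' \o2 H ◁ (G ◁ a) = (H \o1 G) ◁ a \o2 associ H G P.
Proof.
apply/esym/(inv2_l (inv2_assoc _ _ _)).
by rewrite comp2A assoc_nat_r -comp2A associK comp2_id_r.
Qed.

Lemma ins_unit_nat (X : K) (P Q : ob1 X A) (a : ob2 P Q) :
  ins_unit Q \o2 a = U ◁ (F ◁ a) \o2 ins_unit P.
Proof.
rewrite /ins_unit -!comp2A luniti_nat [_ ▷ _ \o2 _]comp2A interchange.
by rewrite !comp2A assoc_nat_r.
Qed.
Lemma ins_counit_nat (X : K) (P Q : ob1 X B) (a : ob2 P Q) :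
  ins_counit Q \o2 F ◁ (U ◁ a) = a \o2 ins_counit P.
Proof.
rewrite /ins_counit -!comp2A associ_nat_r [_ ▷ _ \o2 _]comp2A interchange.
by rewrite !comp2A lunit_nat.
Qed.

Hypothesis (tri1 : adj_tri1) (tri2 : adj_tri2).

Lemma adj_tri1E : ins_counit F \o2 F ◁ eta = runit F.
Proof.
rewrite -[RHS]comp2_id_l; apply/(inv2_r (inv2_sym (inv2_runit _))).
by rewrite -tri1 /ins_counit -!comp2A.
Qed.
Lemma adj_tri2E : U ◁ eps \o2 ins_unit U = runiti U.
Proof.
rewrite -[RHS]comp2_id_r; apply/(inv2_l (inv2_runit _)).
exact: tri2.
Qed.

Lemma ins_zig (X : K) (P : ob1 X A) :
  ins_counit (F \o1 P) \o2 F ◁ ins_unit P = id2 (F \o1 P).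
Proof.
have := congr1 (rwhisk P) tri1; rewrite rwhisk_id !rwhisk_comp => <-.
rewrite /ins_unit /ins_counit -lunit_comp !lwhisk_comp -!comp2A; congr (_ \o2 _).
apply/esym; rewrite comp2A assoc_nat_l -!comp2A; congr (_ \o2 _).
have/esym/(inv2_l (inv2_assoc _ _ _)) -> := pentagon F U F P.
rewrite -!comp2A; congr (_ \o2 (_ \o2 _)).
rewrite [assoc F U F ▷ P \o2 _]comp2A -rwhisk_comp associK rwhisk_id comp2_id_l.
rewrite comp2A assoc_nat_m -comp2A; congr (_ \o2 _).
exact: triangle_inv.
Qed.

Lemma ins_zag (X : K) (P : ob1 X B) :
  U ◁ ins_counit P \o2 ins_unit (U \o1 P) = id2 (U \o1 P).
Proof.
have := congr1 (rwhisk P) tri2; rewrite rwhisk_id !rwhisk_comp => <-.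
rewrite /ins_unit /ins_counit !lwhisk_comp -triangle -!comp2A; congr (_ \o2 _).
apply/esym; rewrite comp2A assoc_nat_m -!comp2A; congr (_ \o2 _).
apply/(inv2_l (inv2_lwhisk _ (inv2_assoc _ _ _))).
rewrite 2!comp2A -(comp2A (U ◁ _)) pentagon -!comp2A; congr (_ \o2 _).
by rewrite comp2A assoc_nat_l -comp2A lunit_comp_inv.
Qed.
End Insert.

Section Whisker.
Variables (A B : K) (F : ob1 A B) (U : ob1 B A).
Variables (eta : ob2 (id1 A) (U \o1 F)) (eps : ob2 (F \o1 U) (id1 B)).

Lemma ins_unitE (X : K) (Y : ob1 X A) :
  ins_unit eta Y = assoc U F Y \o2 (eta ▷ Y \o2 luniti Y).
Proof. by []. Qed.

Lemma ins_counit_comp (X Y : K) (P : ob1 Y B) (Q : ob1 X Y) :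
  ins_counit eps P ▷ Q = ins_counit eps (P \o1 Q)
    \o2 (F ◁ assoc U P Q \o2 assoc F (U \o1 P) Q).
Proof.
rewrite /ins_counit !rwhisk_comp -lunit_comp -!comp2A; congr (_ \o2 _).
rewrite comp2A assoc_nat_l -!comp2A; congr (_ \o2 _).
apply/(inv2_r (inv2_sym (inv2_rwhisk _ (inv2_assoc _ _ _)))).
rewrite -comp2A; apply/(inv2_l (inv2_assoc _ _ _)).
by rewrite -pentagon comp2A.
Qed.
Lemma ins_unit_comp (X Y : K) (P : ob1 Y A) (Q : ob1 X Y) :
  U ◁ assoc F P Q \o2 (assoc U (F \o1 P) Q \o2 ins_unit eta P ▷ Q)
    = ins_unit eta (P \o1 Q).
Proof.
rewrite /ins_unit !rwhisk_comp -lunit_comp_inv !comp2A; congr (_ \o2 _).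
rewrite -[RHS]comp2A -assoc_nat_l [RHS]comp2A -pentagon.
by rewrite [X in _ = X \o2 _]comp2A.
Qed.
End Whisker.

Section Compose.
Variables (A B C : K) (F : ob1 A B) (U : ob1 B A) (G : ob1 B C) (V : ob1 C B).
Variables (etaF : ob2 (id1 A) (U \o1 F)) (epsF : ob2 (F \o1 U) (id1 B)).
Variables (etaG : ob2 (id1 B) (V \o1 G)) (epsG : ob2 (G \o1 V) (id1 C)).

(* id -> U F -> U (V (G F)) -> (U V) (G F) and
   (G F) (U V) -> G (F (U V)) -> G V -> id *)
Definition comp_unit : ob2 (id1 A) ((U \o1 V) \o1 (G \o1 F)) :=
  associ U V (G \o1 F) \o2 (U ◁ ins_unit etaG F \o2 etaF).
Definition comp_counit : ob2 ((G \o1 F) \o1 (U \o1 V)) (id1 C) :=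
  epsG \o2 (G ◁ ins_counit epsF V \o2 assoc G F (U \o1 V)).

Lemma ins_comp_counit (X : K) (Y : ob1 X C) : ins_counit comp_counit Y =
  ins_counit epsG Y \o2 (G ◁ ins_counit epsF (V \o1 Y) \o2
   (G ◁ (F ◁ assoc U V Y) \o2 assoc G F ((U \o1 V) \o1 Y))).
Proof.
rewrite {1 2}/ins_counit /comp_counit !rwhisk_comp -!comp2A.
congr (_ \o2 (_ \o2 _)).
apply/(inv2_l (inv2_assoc _ _ _)).
rewrite !comp2A assoc_nat_m ins_counit_comp !lwhisk_comp -!comp2A.
congr (_ \o2 (_ \o2 _)).
rewrite !comp2A; apply/(inv2_r (inv2_sym (inv2_assoc _ _ _))).
by rewrite -!comp2A pentagon.
Qed.

Lemma ins_comp_unit (X : K) (Y : ob1 X A) : ins_unit comp_unit Y =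
  associ U V ((G \o1 F) \o1 Y) \o2 (U ◁ (V ◁ associ G F Y) \o2
  (U ◁ ins_unit etaG (F \o1 Y) \o2 ins_unit etaF Y)).
Proof.
rewrite (ins_unitE comp_unit) (ins_unitE etaF Y) /comp_unit -ins_unit_comp.
move: (ins_unit etaG F) => I; rewrite !rwhisk_comp !lwhisk_comp.
rewrite !comp2A; do 2 congr (_ \o2 _).
rewrite -[RHS]comp2A -assoc_nat_m !comp2A; congr (_ \o2 _).
apply: (inv2_r (inv2_sym (inv2_rwhisk _ (inv2_assoc _ _ _))) _ _).2.
rewrite -(comp2A (associ _ _ _)) -!lwhisk_comp assocK !lwhisk_id comp2_id_r.
rewrite -!comp2A; apply/(inv2_l (inv2_assoc _ _ _)).
by rewrite pentagon.
Qed.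

Hypothesis tri1F : adj_tri1 etaF epsF.
Hypothesis tri2F : adj_tri2 etaF epsF.
Hypothesis tri1G : adj_tri1 etaG epsG.
Hypothesis tri2G : adj_tri2 etaG epsG.

Lemma comp_tri1 : adj_tri1 comp_unit comp_counit.
Proof.
suff : ins_counit comp_counit (G \o1 F) \o2
    ((G \o1 F) ◁ comp_unit \o2 runiti (G \o1 F)) = id2 (G \o1 F).
  by rewrite /adj_tri1 /ins_counit -!comp2A; apply.
have := ins_zig tri1G F; rewrite ins_comp_counit.
move: (ins_counit epsG _) => J z; rewrite -!comp2A [assoc _ _ _ \o2 _]comp2A assoc_nat_r.
rewrite !comp2A -(comp2A _ (G ◁ (F ◁ assoc _ _ _))) -!lwhisk_comp /comp_unit.
rewrite (comp2A (assoc _ _ _)) associK comp2_id_l lwhisk_comp.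
rewrite -(comp2A _ (G ◁ _) (G ◁ _)) -lwhisk_comp (comp2A (ins_counit _ _)).
rewrite ins_counit_nat -comp2A.
rewrite -(comp2A _ (ins_counit _ _)) (adj_tri1E tri1F).
rewrite lwhisk_comp !comp2A z comp2_id_l -comp2A.
by rewrite comp2A runit_comp runitiK.
Qed.

Lemma comp_tri2 : adj_tri2 comp_unit comp_counit.
Proof.
rewrite /adj_tri2 -/(ins_unit comp_unit (U \o1 V)).
have zF := ins_zag tri2F V; have nG := ins_unit_nat etaG (ins_counit epsF V).
have zG := adj_tri2E tri2G.
rewrite ins_comp_unit /comp_counit.
move: (ins_counit epsF V) zF nG => J zF nG.
rewrite (comp2A (_ ◁ (_ \o2 _))) -associ_nat_r -!comp2A.
rewrite (comp2A (U ◁ _)) -!lwhisk_comp -(comp2A epsG) -(comp2A _ (assoc _ _ _)).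
rewrite associK comp2_id_r (comp2A (U ◁ _)) -lwhisk_comp (lwhisk_comp V) -(comp2A (V ◁ epsG)) -nG.
rewrite (comp2A (V ◁ _)) zG lwhisk_comp -(comp2A (U ◁ _)) zF comp2_id_r.
rewrite -runit_comp -comp2A (comp2A (assoc _ _ _)) associK comp2_id_l.
by rewrite -lwhisk_comp runitiK lwhisk_id.
Qed.

End Compose.

Lemma id_tri1 (A : K) : adj_tri1 (luniti (id1 A)) (lunit (id1 A)).
Proof.
rewrite /adj_tri1 -triangle_inv -comp2A (comp2A (associ _ _ _)) assocK.
rewrite comp2_id_l comp2A lunit_id -comp2A (comp2A (_ ▷ _)) -rwhisk_comp.
by rewrite runitiK rwhisk_id comp2_id_l runitiK.
Qed.

Lemma id_tri2 (A : K) : adj_tri2 (luniti (id1 A)) (lunit (id1 A)).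
Proof.
rewrite /adj_tri2 (comp2A (_ ◁ _)) triangle -lunit_id (comp2A (_ ▷ _)).
by rewrite -rwhisk_comp lunitiK rwhisk_id comp2_id_l lunitiK.
Qed.
End BicategoryTheory.

(* Adj(F -| U) *)
Record adjunction (K : bicategory) (A B : K) (F : ob1 A B) (U : ob1 B A) :=
  Adjunction {
    adj_unit : ob2 (id1 A) (U \o1 F);
    adj_counit : ob2 (F \o1 U) (id1 B);
    adj_triangle1 : adj_tri1 adj_unit adj_counit;
    adj_triangle2 : adj_tri2 adj_unit adj_counit
  }.

Definition adj_id (K : bicategory) (A : K) : adjunction (id1 A) (id1 A) :=
  Adjunction (id_tri1 A) (id_tri2 A).

Definition adj_comp (K : bicategory) (A B C : K) (F : ob1 A B) (U : ob1 B A)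
    (G : ob1 B C) (V : ob1 C B) (a : adjunction F U) (b : adjunction G V) :
    adjunction (G \o1 F) (U \o1 V) :=
  Adjunction
    (comp_tri1 (adj_triangle1 a) (adj_triangle1 b))
    (comp_tri2 (adj_triangle2 a) (adj_triangle2 b)).

Definition ambidextrous_adjoints (K : bicategory) : Prop :=
  (forall (A B : K) (F : ob1 A B), exists U : ob1 B A, inhabited (adjunction F U))
  /\ (forall (A B : K) (F : ob1 A B) (U : ob1 B A),
       inhabited (adjunction F U) -> inhabited (adjunction U F)).

Section Mates.
Variables (K : bicategory) (A B : K) (F G : ob1 A B) (F' G' : ob1 B A).

(* (F' eps_G) (F' theta G') (eta_F G') *)
Definition right_mate (a : adjunction F F') (b : adjunction G G')
    (theta : ob2 F G) : ob2 G' F' :=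
  runit F' \o2 (F' ◁ adj_counit b \o2 (assoc F' G G' \o2
    ((F' ◁ theta) ▷ G' \o2 (adj_unit a ▷ G' \o2 luniti G')))).

(* (eps'_G F') (G' theta F') (G' eta'_F) *)
Definition left_mate (a' : adjunction F' F) (b' : adjunction G' G)
    (theta : ob2 F G) : ob2 G' F' :=
  lunit F' \o2 (adj_counit b' ▷ F' \o2 ((G' ◁ theta) ▷ F' \o2
    (associ G' F F' \o2 (G' ◁ adj_unit a' \o2 runiti G')))).
End Mates.

Record even_handed (K : bicategory) := EvenHanded {
  eh_map :> forall (A B : K) (F : ob1 A B) (F' : ob1 B A),
    adjunction F F' -> adjunction F' F;
  eh_invol : forall (A B : K) (F : ob1 A B) (F' : ob1 B A)
      (a : adjunction F F'),
    eh_map (eh_map a) = a;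
  eh_comp : forall (A B C : K) (F : ob1 A B) (F' : ob1 B A)
      (G : ob1 B C) (G' : ob1 C B) (a : adjunction F F') (b : adjunction G G'),
    eh_map (adj_comp a b) = adj_comp (eh_map b) (eh_map a);
  eh_id : forall A : K, eh_map (adj_id A) = adj_id A;
  eh_mates : forall (A B : K) (F G : ob1 A B) (F' G' : ob1 B A)
      (a : adjunction F F') (b : adjunction G G') (theta : ob2 F G),
    right_mate a b theta = left_mate (eh_map a) (eh_map b) theta
}.
Arguments eh_map {K} _ {A B F F'}.

Local Open Scope ring_scope.

Record hilbert (C : numClosedFieldType) := Hilbert {
  hilbert_sort :> vectType C;
  hilbert_dot : {dot hilbert_sort for (@Num.conj C)}
}.

(* The arguments are swapped because the library's forms are linear in the
   first variable. *)
Definition ip (C : numClosedFieldType) (V : hilbert C) (u v : V) : C :=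
  hilbert_dot V v u.

Section HilbertSpaces.
Variable C : numClosedFieldType.
Implicit Types V W : hilbert C.

Lemma ip_linear V (u : V) : linear_for *%R (ip u).
Proof. by move=> a v w; rewrite /ip linearPl. Qed.

Lemma ipC V (u v : V) : ip v u = (ip u v)^*.
Proof. by rewrite /ip (hermC (hilbert_dot V)) expr0 mul1r. Qed.

Lemma ip_eq0 V (u : V) : (ip u u == 0) = (u == 0).
Proof. exact: dnorm_eq0. Qed.

HB.instance Definition _ V (u : V) :=
  GRing.isLinear.Build C V C^o *:%R (ip u : V -> C^o) (@ip_linear V u).

Lemma ip_inj V (u v : V) : (forall w, ip u w = ip v w) -> u = v.
Proof.
move=> e; apply/eqP; rewrite -subr_eq0 -ip_eq0 linearB /=.
by rewrite (ipC u) (ipC v) !e subrr.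
Qed.

Lemma riesz V (l : {linear V -> C^o}) : exists v : V, forall u, ip v u = l u.
Proof.
pose b := vbasis (fullv : {vspace V}).
pose T (v : V) : 'rV[C]_(\dim (fullv : {vspace V})) := \row_i ip b`_i v.
have Tl : linear T by move=> a u v; apply/rowP=> i; rewrite !mxE linearP.
pose Ti := GRing.isLinear.Build _ _ _ _ T Tl.
pose TL : {linear V -> 'rV[C]_(\dim (fullv : {vspace V}))} := HB.pack T Ti.
pose t := linfun TL.
have bE u : u = \sum_i coord b i u *: b`_i by apply: coord_vbasis; rewrite memvf.
have kt : lker t == 0%VS.
  apply/lker0P => u v; rewrite !lfunE /= => /rowP e.
  apply: ip_inj => w; rewrite (bE w) !linear_sum; apply: eq_bigr => i _.
  by rewrite !linearZ /=; have := e i; rewrite !mxE ipC [RHS]ipC => /(can_inj conjCK) ->.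
have it : limg t = fullv.
  apply/eqP; rewrite eqEdim subvf limg_dim_eq ?(eqP kt) ?capv0 //=.
  by rewrite !dimvf dim_matrix mul1r.
pose w : 'rV[C]_(\dim (fullv : {vspace V})) := \row_i (l b`_i)^*.
have /memv_imgP[v _ wE] : w \in limg t by rewrite it memvf.
exists v => u; rewrite (bE u) !linear_sum; apply: eq_bigr => i _.
rewrite !linearZ /=; congr (_ * _).
by move: wE; rewrite lfunE /= => /rowP/(_ i); rewrite !mxE => /(congr1 Num.conj); rewrite conjCK -ipC.
Qed.

(* The set is a singleton by [riesz] and [ip_inj]; see [hilbert_adjP]. *)
Definition hilbert_adj V W (f : 'Hom(V, W)) (w : W) : V :=
  xget 0 [set v : V | forall u : V, ip v u = ip w (f u)].

Lemma hilbert_adjP V W (f : 'Hom(V, W)) (w : W) (u : V) :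
  ip (hilbert_adj f w) u = ip w (f u).
Proof.
have l_lin : linear (fun u => ip w (f u) : C^o).
  by move=> a v v'; rewrite linearP ip_linear.
pose li := GRing.isLinear.Build C V C^o *:%R _ l_lin.
pose l : {linear V -> C^o} := HB.pack (fun u => ip w (f u) : C^o) li.
have [v vP] := riesz l.
by rewrite /hilbert_adj; case: xgetP => [x _ ->//|/(_ v)] /(_ vP).
Qed.
End HilbertSpaces.

(* H*-categories; over C = R[i] the hom-spaces are finite-dimensional complex
   Hilbert spaces. *)
Record hcat (C : numClosedFieldType) := HCat {
  hob :> Type;
  hhom : hob -> hob -> hilbert C;
  hid : forall x, hhom x x;
  hcomp : forall x y z, hhom y z -> hhom x y -> hhom x z;
  hstar : forall x y, hhom x y -> hhom y x;
  hcompA : forall w x y z (f : hhom y z) (g : hhom x y) (h : hhom w x),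
    hcomp f (hcomp g h) = hcomp (hcomp f g) h;
  hcomp_id_l : forall x y (f : hhom x y), hcomp (hid y) f = f;
  hcomp_id_r : forall x y (f : hhom x y), hcomp f (hid x) = f;
  hcomp_linear_l : forall x y z (g : hhom x y),
    linear (fun f : hhom y z => hcomp f g);
  hcomp_linear_r : forall x y z (f : hhom y z), linear (@hcomp x y z f);
  hstar_antilinear : forall x y (a : C) (f g : hhom x y),
    hstar (a *: f + g) = a^* *: hstar f + hstar g;
  hstarK : forall x y (f : hhom x y), hstar (hstar f) = f;
  hstar_comp : forall x y z (f : hhom y z) (g : hhom x y),
    hstar (hcomp f g) = hcomp (hstar g) (hstar f);
  ip_star_l : forall x y z (f : hhom y z) (g : hhom x y) (h : hhom x z),
    ip (hcomp f g) h = ip g (hcomp (hstar f) h);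
  ip_star_r : forall x y z (f : hhom y z) (g : hhom x y) (h : hhom x z),
    ip (hcomp f g) h = ip f (hcomp h (hstar g))
}.
Arguments hhom {C _}.
Arguments hid {C _}.
Arguments hcomp {C _ x y z}.
Arguments hstar {C _ x y}.
Notation "f \h g" := (hcomp f g) (at level 40, left associativity).

Section TwoHilbertSpaces.
Variables (C : numClosedFieldType) (H : hcat C).

Definition hiso (x y : H) : Prop :=
  exists (f : hhom x y) (g : hhom y x), g \h f = hid x /\ f \h g = hid y.

Definition hmono (x y : H) (m : hhom x y) : Prop :=
  forall w (f g : hhom w x), m \h f = m \h g -> f = g.

Definition hsimple (x : H) : Prop :=
  hid x <> 0 /\
  forall (y : H) (m : hhom y x), hmono m ->
    m = 0 \/ exists n : hhom x y, n \h m = hid y /\ m \h n = hid x.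

(* n = 0 gives a zero object *)
Definition has_direct_sums : Prop :=
  forall (n : nat) (x : 'I_n -> H),
  exists (z : H) (i : forall k, hhom (x k) z) (p : forall k, hhom z (x k)),
    [/\ forall k, p k \h i k = hid (x k),
        forall j k, j != k -> p k \h i j = 0
      & \sum_k i k \h p k = hid z].

Definition idempotents_split : Prop :=
  forall (x : H) (e : hhom x x), e \h e = e ->
  exists (y : H) (r : hhom x y) (s : hhom y x), s \h r = e /\ r \h s = hid y.

Definition cauchy_complete : Prop := has_direct_sums /\ idempotents_split.

Definition finitely_many_simples : Prop :=
  exists (n : nat) (s : 'I_n -> H),
  forall x : H, hsimple x -> exists i, hiso x (s i).
End TwoHilbertSpaces.

Record two_hilbert (C : numClosedFieldType) := TwoHilbert {
  two_hilbert_cat :> hcat C;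
  two_hilbert_cauchy : cauchy_complete two_hilbert_cat;
  two_hilbert_fd : finitely_many_simples two_hilbert_cat
}.

Record star_functor (C : numClosedFieldType) (A B : hcat C) := StarFunctor {
  fob :> A -> B;
  fmap : forall x y, hhom x y -> hhom (fob x) (fob y);
  fmap_id : forall x, fmap (hid x) = hid (fob x);
  fmap_comp : forall x y z (f : hhom y z) (g : hhom x y),
    fmap (f \h g) = fmap f \h fmap g;
  fmap_linear : forall x y, linear (@fmap x y);
  fmap_star : forall x y (f : hhom x y), fmap (hstar f) = hstar (fmap f)
}.
Arguments fmap {C A B} _ {x y}.

Record nat_trans (C : numClosedFieldType) (A B : hcat C)
    (F G : star_functor A B) := NatTrans {
  nt_comp :> forall x : A, hhom (F x) (G x);
  nt_nat : forall (x y : A) (f : hhom x y),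
    nt_comp y \h fmap F f = fmap G f \h nt_comp x
}.

Lemma nat_transP (C : numClosedFieldType) (A B : hcat C)
    (F G : star_functor A B) (a b : nat_trans F G) :
  (forall x, a x = b x) -> a = b.
Proof.
case: a b => [a an] [b bn] /= e.
have {e} e : a = b by apply: functional_extensionality_dep.
by subst b; congr NatTrans; apply: Prop_irrelevance.
Qed.

Section TwoHilb.
Variable C : numClosedFieldType.
Implicit Types A B D E : two_hilbert C.

Definition id_functor A : star_functor A A.
Proof. by exists id (fun _ _ f => f). Defined.

Definition comp_functor A B D (G : star_functor B D) (F : star_functor A B) :
  star_functor A D.
Proof.
exists (fun x => G (F x)) (fun _ _ f => fmap G (fmap F f)).
- by move=> x; rewrite !fmap_id.
- by move=> x y z f g; rewrite !fmap_comp.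
- by move=> x y a f g; rewrite !fmap_linear.
- by move=> x y f; rewrite !fmap_star.
Defined.

Lemma hid_nat A B (F : star_functor A B) (x y : A) (f : hhom x y) :
  hid (F y) \h fmap F f = fmap F f \h hid (F x).
Proof. by rewrite hcomp_id_l hcomp_id_r. Qed.

Definition id_nt A B (F : star_functor A B) : nat_trans F F :=
  @NatTrans _ _ _ F F (fun x => hid (F x)) (hid_nat F).

Definition comp_nt A B (F G H : star_functor A B) (b : nat_trans G H)
  (a : nat_trans F G) : nat_trans F H.
Proof.
exists (fun x => b x \h a x) => x y f.
by rewrite -hcompA nt_nat !hcompA nt_nat.
Defined.

Definition lwhisk_nt A B D (G : star_functor B D) (F F' : star_functor A B)
  (a : nat_trans F F') : nat_trans (comp_functor G F) (comp_functor G F').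
Proof.
by exists (fun x => fmap G (a x)) => x y f /=; rewrite -!fmap_comp nt_nat.
Defined.

Definition rwhisk_nt A B D (G G' : star_functor B D) (F : star_functor A B)
  (b : nat_trans G G') : nat_trans (comp_functor G F) (comp_functor G' F).
Proof. by exists (fun x => b (F x)) => x y f /=; rewrite nt_nat. Defined.

Section Associator.
Variables (A B D E : two_hilbert C).
Variables (H : star_functor D E) (G : star_functor B D) (F : star_functor A B).
Let HGl := comp_functor (comp_functor H G) F.
Let HGr := comp_functor H (comp_functor G F).
Definition assoc_nt : nat_trans HGl HGr :=
  @NatTrans _ _ _ HGl HGr (fun x => hid (H (G (F x)))) (hid_nat HGr).
Definition associ_nt : nat_trans HGr HGl :=
  @NatTrans _ _ _ HGr HGl (fun x => hid (H (G (F x)))) (hid_nat HGr).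
End Associator.

Section Unitors.
Variables (A B : two_hilbert C) (F : star_functor A B).
Let lF := comp_functor (id_functor B) F.
Let Fr := comp_functor F (id_functor A).
Definition lunit_nt : nat_trans lF F :=
  @NatTrans _ _ _ lF F (fun x => hid (F x)) (hid_nat F).
Definition luniti_nt : nat_trans F lF :=
  @NatTrans _ _ _ F lF (fun x => hid (F x)) (hid_nat F).
Definition runit_nt : nat_trans Fr F :=
  @NatTrans _ _ _ Fr F (fun x => hid (F x)) (hid_nat F).
Definition runiti_nt : nat_trans F Fr :=
  @NatTrans _ _ _ F Fr (fun x => hid (F x)) (hid_nat F).
End Unitors.

Definition TwoHilb : bicategory.
Proof.
refine (@Bicategory (two_hilbert C) (@star_functor C) (@nat_trans C)
  id_functor comp_functor id_nt comp_nt lwhisk_nt rwhisk_nt assoc_nt associ_nt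
  lunit_nt luniti_nt runit_nt runiti_nt
  _ _ _ _ _ _ _ _ _ _ _ _ _ _ _ _ _ _ _ _ _);
  abstract (by intros; apply: nat_transP => x /=;
    rewrite ?nt_nat ?fmap_comp ?fmap_id ?hcomp_id_l ?hcomp_id_r ?hcompA
      ?fmap_id ?hcomp_id_l).
Defined.
End TwoHilb.


Section Traces.
Variables (C : numClosedFieldType).

Definition Tr (H : hcat C) (x : H) (f : hhom x x) : C := ip (hid x) f.

Definition dual (V : vectType C) : vectType C := 'Hom(V, C^o).
Definition dual_map (V W : vectType C) (f : 'Hom(V, W)) :
    'Hom(dual W, dual V) :=
  linfun (fun l : dual W => (l \o f)%VF : dual V).

Definition trace_iso (H : hcat C) (x y : H) :
    'Hom(hhom x y, dual (hhom y x)) :=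
  linfun (fun f : hhom x y =>
    linfun (fun g : hhom y x => Tr (g \h f) : C^o) : dual (hhom y x)).

Lemma trace_isoE (H : hcat C) (x y : H) (f : hhom x y) (g : hhom y x) :
  trace_iso x y f g = Tr (g \h f).
Proof.
have lg (f' : hhom x y) :
    linear (fun g' : hhom y x => Tr (g' \h f') : C^o).
  by move=> a u v; rewrite /Tr hcomp_linear_l ip_linear.
have lgE f' g' : linfun (fun g' : hhom y x => Tr (g' \h f') : C^o) g' =
    Tr (g' \h f').
  pose i := GRing.isLinear.Build _ _ _ _ _ (lg f').
  pose l : {linear hhom y x -> C^o} :=
    HB.pack (fun g' : hhom y x => Tr (g' \h f') : C^o) i.
  exact: (lfunE l).
have lf : linear (fun f' : hhom x y =>
    linfun (fun g' : hhom y x => Tr (g' \h f') : C^o) : dual (hhom y x)).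
  move=> a u v; apply/lfunP => g'; rewrite add_lfunE scale_lfunE !lgE.
  by rewrite /Tr hcomp_linear_r ip_linear.
pose i := GRing.isLinear.Build _ _ _ _ _ lf.
pose l : {linear hhom x y -> dual (hhom y x)} := HB.pack (fun f' : hhom x y =>
    linfun (fun g' : hhom y x => Tr (g' \h f') : C^o) : dual (hhom y x)) i.
by rewrite -lgE; congr (fun_of_lfun _ g); apply: (lfunE l).
Qed.

Lemma trace_iso_inj (H : hcat C) (x y : H) : lker (trace_iso x y) == 0%VS.
Proof.
rewrite -subv0; apply/subvP => f; rewrite memv_ker memv0 => /eqP e.
rewrite -ip_eq0 -{1}[f]hcomp_id_r ip_star_l -/(Tr (hstar f \h f)) -trace_isoE e.
by rewrite zero_lfunE.
Qed.

Lemma trace_iso_surj (H : hcat C) (x y : H) : limg (trace_iso x y) = fullv.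
Proof.
have dimE (z w : H) : \dim (limg (trace_iso z w)) = \dim (fullv : {vspace hhom z w}).
  by rewrite limg_dim_eq // (eqP (trace_iso_inj z w)) capv0.
have dual_dim (V : vectType C) :
    \dim (fullv : {vspace dual V}) = \dim (fullv : {vspace V}).
  by rewrite !dimvf; apply: muln1.
have le (z w : H) : (\dim (fullv : {vspace hhom z w}) <=
    \dim (fullv : {vspace hhom w z}))%N.
  by have := dimvS (subvf (limg (trace_iso z w))); rewrite dimE dual_dim.
by apply/eqP; rewrite eqEdim subvf dual_dim dimE le.
Qed.

(* s_B^-1 o phi^v o s_A; by [trace_iso_inj] and [trace_iso_surj] the
   pseudo-inverse of a linear map used here is the inverse. *)
Definition trace_transpose (A B : hcat C) (x' x : A) (y' y : B)
    (phi : 'Hom(hhom y' y, hhom x x')) : 'Hom(hhom x' x, hhom y y') :=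
  ((trace_iso y y')^-1 \o (dual_map phi \o trace_iso x' x))%VF.

(* phi : Hom(F x, y) -> Hom(x, F' y) *)
Definition adj_hom (A B : two_hilbert C) (F : star_functor A B)
    (F' : star_functor B A) (a : @adjunction (TwoHilb C) A B F F') (x : A) (y : B) :
    'Hom(hhom (F x) y, hhom x (F' y)) :=
  linfun (fun f : hhom (F x) y => fmap F' f \h adj_unit a x).
Lemma adj_homE (A B : two_hilbert C) (F : star_functor A B)
    (F' : star_functor B A) (a : @adjunction (TwoHilb C) A B F F')
    (x : A) (y : B) (f : hhom (F x) y) :
  adj_hom a x y f = fmap F' f \h adj_unit a x.
Proof.
have l_lin : linear (fun f : hhom (F x) y => fmap F' f \h adj_unit a x).
  by move=> c u v; rewrite fmap_linear hcomp_linear_l.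
pose i := GRing.isLinear.Build _ _ _ _ _ l_lin.
pose l : {linear hhom (F x) y -> hhom x (F' y)} :=
  HB.pack (fun f : hhom (F x) y => fmap F' f \h adj_unit a x) i.
exact: (lfunE l).
Qed.

End Traces.

(* Main.v *)
From HB Require Import structures.
Require Import Defs.
From mathcomp Require Import all_boot all_order all_algebra.
From mathcomp Require Import sesquilinear spectral boolp reals complex.

Set Implicit Arguments.
Unset Strict Implicit.
Unset Printing Implicit Defensive.

Import Order.TTheory GRing.Theory Num.Theory VectorInternalTheory.
Local Open Scope ring_scope.

(** Two things have to be shown: every *-functor [F : A -> B] has a right
    adjoint that is again a *-functor, and the trace transpose turns an
    adjunction [F ⊣ U] into an adjunction [U ⊣ F] in an even-handed way.

    The transpose.  Write [a(f)] for the adjoint map [x -> U y] of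
    [f : F x -> y].  An adjunction [b : U ⊣ F] is the trace transpose of
    [a : F ⊣ U] when [Tr (f b(g)) = Tr (a(f) g)] for all [f : F x -> y] and
    [g : U y -> x] ([transposed]).  The trace is cyclic, since
    [Tr (f g) = (f*, g)] and stars reverse inner products, and the pairing
    [f, g |-> Tr (f g)] is perfect.  Hence such a [b] is unique, and it exists:
    its unit and counit are the vectors that represent the functionals which
    the equation imposes on them, and naturality and the triangle identities
    are checked under the trace ([transposed_exists]).  All the axioms of an
    even-handed structure follow formally.  The relation is symmetric by
    cyclicity, which makes the transpose an involution; it is stable under
    composition because composing adjunctions composes the maps [a(-)]; and
    after pairing with an arbitrary morphism the two mates of a natural
    transformation have the same trace ([transposed_mates]).  Read through
    [Tr (f h) = (f*, h)], the defining equation says that [b(g)*] is the image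
    of [g*] under the Hilbert space adjoint of [a(-)], which is the formula
    with the *-structure.

    Right adjoints.  For [y] in [B] one needs an object [u] and a morphism
    [eps : F u -> y] such that [f |-> eps F(f)] is a bijection from [Hom(x, u)]
    to [Hom(F x, y)] for every [x].  The resulting functor [y |-> u] preserves
    the * as soon as these bijections are unitary, because then the Hilbert
    space adjoints of composition with [k] and with its image correspond to
    each other.  Unitary representing morphisms are built from semisimplicity.
    An object whose endomorphism algebra is not spanned by the identity has a
    nontrivial idempotent endomorphism: a non-scalar endomorphism minus one of
    its eigenvalues annihilates a nonzero proper right ideal of the endomorphism
    algebra, and the orthogonal projection of the identity to this ideal is an
    idempotent that generates it ([ideal_projection]).  Splitting idempotents, by
    induction on the dimension of the endomorphism algebra, shows that a morphism
    which vanishes on all maps from simple objects is zero ([atoms_separate]).  Now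
    take a finite list of inequivalent simple objects [s i], an object [u] with
    [dim Hom(s i, u) = dim Hom(F (s i), y)], and orthonormal bases [e i k] and
    [g i k] of these two spaces.  The morphism
    [eps = \sum_(i, k) (id, id) g i k F(hstar (e i k))], where [id] is the
    identity of [s i], sends [e i k] to [g i k], so it is unitary on maps from
    the [s i], and the decomposition of every identity into maps through the
    [s i] ([resolution]) extends this to all [x]. *)

Local Notation "F ⊣ U" := (@adjunction (TwoHilb _) _ _ F U) (at level 70).

(** * Inner products, stars and traces on hom-spaces *)

Section Hilbert.
Variable C : numClosedFieldType.
Implicit Types V W : hilbert C.

(** Lets a function that is only propositionally linear use the kernels, images
    and dimension counts of bundled linear maps. *)
Lemma lfun_of_linear (V W : vectType C) (f : V -> W) :
  linear f -> exists L : 'Hom(V, W), forall v, L v = f v.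
Proof.
move=> lf; pose i := GRing.isLinear.Build _ _ _ _ f lf.
pose l : {linear V -> W} := HB.pack f i.
by exists (linfun l) => v; rewrite lfunE.
Qed.

Lemma ip_injr V (u v : V) : (forall w, ip w u = ip w v) -> u = v.
Proof. by move=> e; apply: ip_inj => w; rewrite !(ipC w) e. Qed.

Lemma ipZl V a (u v : V) : ip (a *: u) v = a^* * ip u v.
Proof. by rewrite [LHS]ipC linearZ /= rmorphM /= [ip u v]ipC. Qed.

Lemma ip_suml V I (r : seq I) (P : pred I) (F : I -> V) v :
  ip (\sum_(i <- r | P i) F i) v = \sum_(i <- r | P i) ip (F i) v.
Proof.
rewrite [LHS]ipC linear_sum rmorph_sum.
by apply: eq_bigr => i _; rewrite [RHS]ipC.
Qed.

Lemma ip0r V (u : V) : ip u 0 = 0.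
Proof. exact: linear0. Qed.

Lemma ipZr V a (u v : V) : ip u (a *: v) = a * ip u v.
Proof. exact: linearZ. Qed.

Lemma ipBr V (u v w : V) : ip u (v - w) = ip u v - ip u w.
Proof. exact: linearB. Qed.

Lemma ip_sumr V I (r : seq I) (P : pred I) (F : I -> V) u :
  ip u (\sum_(i <- r | P i) F i) = \sum_(i <- r | P i) ip u (F i).
Proof. exact: linear_sum. Qed.

Lemma ip_ge0 V (u : V) : 0 <= ip u u.
Proof. exact: dnorm_ge0. Qed.

End Hilbert.

Section HStar.
Variables (C : numClosedFieldType) (H : hcat C).
Implicit Types x y z w : H.

HB.instance Definition _ x y z (f : hhom y z) :=
  GRing.isLinear.Build C (hhom x y) (hhom x z) *:%R (hcomp f)
    (@hcomp_linear_r C H x y z f).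

(** Precomposition with the morphisms in the reverse order, so that its linearity
    can be registered as a structure. *)
Definition hcompr x y z (g : hhom x y) (f : hhom y z) := f \h g.

HB.instance Definition _ x y z (g : hhom x y) :=
  GRing.isLinear.Build C (hhom y z) (hhom x z) *:%R (@hcompr x y z g)
    (@hcomp_linear_l C H x y z g).

Section Composition.
Variables (x y z : H).
Implicit Types (f : hhom y z) (g : hhom x y).

Lemma hcomp0r f : f \h (0 : hhom x y) = 0. Proof. exact: linear0. Qed.
Lemma hcompBr f g g' : f \h (g - g') = f \h g - f \h g'.
Proof. exact: linearB. Qed.
Lemma hcompDr f g g' : f \h (g + g') = f \h g + f \h g'.
Proof. exact: linearD. Qed.
Lemma hcompZr a f g : f \h (a *: g) = a *: (f \h g).
Proof. exact: linearZ. Qed.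
Lemma hcomp_sumr I (r : seq I) (P : pred I) f (G : I -> hhom x y) :
  f \h (\sum_(i <- r | P i) G i) = \sum_(i <- r | P i) f \h G i.
Proof. exact: linear_sum. Qed.

Lemma hcomp0l g : (0 : hhom y z) \h g = 0.
Proof. exact: (linear0 (hcompr g)). Qed.
Lemma hcompBl f f' g : (f - f') \h g = f \h g - f' \h g.
Proof. exact: (linearB (hcompr g)). Qed.
Lemma hcompZl a f g : (a *: f) \h g = a *: (f \h g).
Proof. exact: (linearZ_LR (hcompr g)). Qed.
Lemma hcomp_suml I (r : seq I) (P : pred I) (F : I -> hhom y z) g :
  (\sum_(i <- r | P i) F i) \h g = \sum_(i <- r | P i) F i \h g.
Proof. exact: (linear_sum (hcompr g)). Qed.
End Composition.

Section Star.
Variables (x y : H).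
Implicit Types (f g : hhom x y).

Lemma hstarD f g : hstar (f + g) = hstar f + hstar g.
Proof. by have := hstar_antilinear 1 f g; rewrite !scale1r rmorph1 scale1r. Qed.

Lemma hstar0 : hstar (0 : hhom x y) = 0.
Proof. by apply: (addrI (hstar (0 : hhom x y))); rewrite -hstarD !addr0. Qed.

Lemma hstar_inj f g : hstar f = hstar g -> f = g.
Proof. by move=> e; rewrite -(hstarK f) e hstarK. Qed.
End Star.

Lemma ip_hstar x y (f g : hhom x y) : ip (hstar f) (hstar g) = ip g f.
Proof.
rewrite -[hstar f in LHS]hcomp_id_r ip_star_l hstarK.
by rewrite -[g in RHS]hcomp_id_l ip_star_r.
Qed.

Lemma TrE x y (f : hhom y x) (g : hhom x y) : Tr (f \h g) = ip (hstar f) g.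
Proof. by rewrite /Tr -[hstar f]hcomp_id_r ip_star_l hstarK. Qed.

(** Cyclicity is the only property of the traces, besides nondegeneracy, on which
    the even-handed structure rests. *)
Lemma TrC x y (f : hhom y x) (g : hhom x y) : Tr (f \h g) = Tr (g \h f).
Proof. by rewrite !TrE -ip_hstar hstarK. Qed.

Lemma Tr_inj x y (g g' : hhom x y) :
  (forall f, Tr (f \h g) = Tr (f \h g')) -> g = g'.
Proof.
by move=> e; apply: ip_injr => w; have := e (hstar w); rewrite !TrE hstarK.
Qed.

(** The trace pairing is perfect: it is the inner product after a star, so the
    Riesz representation theorem applies. *)
Lemma Tr_repr x y (l : hhom y x -> C^o) : linear l ->
  exists g : hhom x y, forall f, Tr (f \h g) = l f.
Proof.
move=> ll; pose i := GRing.isLinear.Build _ _ _ _ l ll.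
pose L : {linear hhom y x -> C^o} := HB.pack l i.
have [v vP] := riesz L.
by exists (hstar v) => f; rewrite TrC TrE hstarK vP.
Qed.

Lemma ip_comp_adj x y z (f : hhom y z) (g : hhom x y) (h : hhom x z) :
  ip h (f \h g) = ip (hstar f \h h) g.
Proof. by rewrite [LHS]ipC ip_star_l [RHS]ipC. Qed.

End HStar.

Section StarFunctors.
Variables (C : numClosedFieldType) (A B : hcat C) (F : star_functor A B).

HB.instance Definition _ x y :=
  GRing.isLinear.Build C (hhom x y) (hhom (F x) (F y)) *:%R (@fmap C A B F x y)
    (@fmap_linear C A B F x y).

Lemma fmap0 x y : fmap F (0 : hhom x y) = 0. Proof. exact: linear0. Qed.
Lemma fmapZ x y a (f : hhom x y) : fmap F (a *: f) = a *: fmap F f.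
Proof. exact: linearZ. Qed.
Lemma fmap_sum x y I (r : seq I) (P : pred I) (G : I -> hhom x y) :
  fmap F (\sum_(i <- r | P i) G i) = \sum_(i <- r | P i) fmap F (G i).
Proof. exact: linear_sum. Qed.
End StarFunctors.

(** * Adjunctions between star functors *)

Section Adjunctions.
Variables (C : numClosedFieldType) (A B : two_hilbert C).
Variables (F : star_functor A B) (U : star_functor B A).
Variable a : F ⊣ U.

Lemma adj_unit_nat (x y : A) (f : hhom x y) :
  adj_unit a y \h f = fmap U (fmap F f) \h adj_unit a x.
Proof. exact: (nt_nat (adj_unit a)). Qed.

Lemma adj_counit_nat (x y : B) (f : hhom x y) :
  adj_counit a y \h fmap F (fmap U f) = f \h adj_counit a x.
Proof. exact: (nt_nat (adj_counit a)). Qed.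

(** In this 2-category all constraint cells have identity components, so the
    triangle identities reduce to their textbook form. *)
Lemma adj_zig (x : A) :
  adj_counit a (F x) \h fmap F (adj_unit a x) = hid (F x).
Proof.
have := congr1 (fun t : nat_trans F F => t x) (adj_triangle1 a).
by rewrite /= hcomp_id_l hcomp_id_r hcomp_id_l.
Qed.

Lemma adj_zag (y : B) :
  fmap U (adj_counit a y) \h adj_unit a (U y) = hid (U y).
Proof.
have := congr1 (fun t : nat_trans U U => t y) (adj_triangle2 a).
by rewrite /= !hcomp_id_l hcomp_id_r.
Qed.

(** The formula for the inverse of the adjunction isomorphism. *)
Lemma adj_homK (x : A) (y : B) (h : hhom x (U y)) :
  fmap U (adj_counit a y \h fmap F h) \h adj_unit a x = h.
Proof. by rewrite fmap_comp -hcompA -adj_unit_nat hcompA adj_zag hcomp_id_l. Qed.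

Lemma adj_of_families
    (eta : forall x : A, hhom x (U (F x)))
    (eps : forall y : B, hhom (F (U y)) y) :
  (forall (x y : A) (f : hhom x y), eta y \h f = fmap U (fmap F f) \h eta x) ->
  (forall (x y : B) (f : hhom x y), eps y \h fmap F (fmap U f) = f \h eps x) ->
  (forall x, eps (F x) \h fmap F (eta x) = hid (F x)) ->
  (forall y, fmap U (eps y) \h eta (U y) = hid (U y)) ->
  exists b : F ⊣ U, (forall x, adj_unit b x = eta x) /\
    (forall y, adj_counit b y = eps y).
Proof.
move=> nu nc zig zag.
pose u := NatTrans (F := id_functor A) (G := comp_functor U F) nu.
pose c := NatTrans (F := comp_functor F U) (G := id_functor B) nc.
have t1 : @adj_tri1 (TwoHilb C) A B F U u c.
  by apply: nat_transP => x /=; rewrite hcomp_id_l hcomp_id_r hcomp_id_l.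
have t2 : @adj_tri2 (TwoHilb C) A B F U u c.
  by apply: nat_transP => x /=; rewrite !hcomp_id_l hcomp_id_r.
by exists (Adjunction t1 t2).
Qed.
End Adjunctions.

(** Adjunctions between the same functors are determined by their units: the
    counits are recovered as the inverse bijections applied to identities. *)
Lemma adj_eq (C : numClosedFieldType) (A B : two_hilbert C)
    (F : star_functor A B) (U : star_functor B A) (a b : F ⊣ U) :
  (forall x, adj_unit a x = adj_unit b x) -> a = b.
Proof.
move=> eu.
have ec y : adj_counit a y = adj_counit b y.
  have e : adj_counit a y = adj_counit a y \h
      fmap F (fmap U (adj_counit b y) \h adj_unit a (U y)).
    by rewrite eu adj_zag fmap_id hcomp_id_r.
  by rewrite e fmap_comp hcompA adj_counit_nat -hcompA adj_zig hcomp_id_r.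
case: a b eu ec => [ua ca t1 t2] [ub cb s1 s2] /= eu ec.
have {eu} eu : ua = ub by apply: nat_transP.
have {ec} ec : ca = cb by apply: nat_transP.
subst ub cb; congr Adjunction; exact: Prop_irrelevance.
Qed.

(** * Transposing an adjunction along the traces *)

Section Transposition.
Variable C : numClosedFieldType.

(** [b] is the structure arising from the traces that is attached to [a], stated
    as a relation between the two adjunction isomorphisms.  Working with the
    relation makes the axioms of an even-handed structure consequences of
    uniqueness. *)
Definition transposed (A B : two_hilbert C) (F : star_functor A B)
    (U : star_functor B A) (a : F ⊣ U) (b : U ⊣ F) : Prop :=
  forall (x : A) (y : B) (f : hhom (F x) y) (g : hhom (U y) x),
    Tr (f \h (fmap F g \h adj_unit b y)) = Tr ((fmap U f \h adj_unit a x) \h g).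

Section Pair.
Variables (A B : two_hilbert C) (F : star_functor A B) (U : star_functor B A).

Lemma transposed_sym (a : F ⊣ U) (b : U ⊣ F) : transposed a b -> transposed b a.
Proof. by move=> t y x g f; rewrite [LHS]TrC [RHS]TrC (t x y f g). Qed.

Lemma transposed_uniq (a : F ⊣ U) (b b' : U ⊣ F) :
  transposed a b -> transposed a b' -> b = b'.
Proof.
move=> t t'; apply: adj_eq => y; apply: Tr_inj => f.
have := etrans (t _ _ f (hid _)) (esym (t' _ _ f (hid _))).
by rewrite fmap_id !hcomp_id_l.
Qed.

(** The relation, read at [g = id] and at [b(g) = id], prescribes the traces of
    the unit and of the counit of [b] against all morphisms, which determines both
    of them because the trace pairing is perfect. *)
Lemma transposed_exists (a : F ⊣ U) : exists b : U ⊣ F, transposed a b.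
Proof.
have unit_repr (y : B) : exists h : hhom y (F (U y)),
    forall f, Tr (f \h h) = Tr (fmap U f \h adj_unit a (U y)).
  by apply: Tr_repr => c f g; rewrite fmap_linear hcomp_linear_l /Tr ip_linear.
have counit_repr (x : A) : exists h : hhom (U (F x)) x,
    forall k, Tr (k \h h) = Tr (adj_counit a (F x) \h fmap F k).
  by apply: Tr_repr => c f g; rewrite fmap_linear hcomp_linear_r /Tr ip_linear.
pose eta y := sval (cid (unit_repr y)).
pose eps x := sval (cid (counit_repr x)).
have etaE y f : Tr (f \h eta y) = Tr (fmap U f \h adj_unit a (U y)).
  exact: (svalP (cid (unit_repr y))).
have epsE x k : Tr (k \h eps x) = Tr (adj_counit a (F x) \h fmap F k).
  exact: (svalP (cid (counit_repr x))).
have etaT (x : A) (y : B) (f : hhom (F x) y) (g : hhom (U y) x) :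
    Tr (f \h (fmap F g \h eta y)) = Tr ((fmap U f \h adj_unit a x) \h g).
  by rewrite hcompA etaE fmap_comp -!hcompA adj_unit_nat.
(* each identity below is tested by composing with an arbitrary morphism and
   taking the trace, which exchanges it for one that holds for [a] *)
have [||||b [bu _]] := @adj_of_families C B A U F eta eps.
- move=> y y' k; apply: Tr_inj => f.
  rewrite etaT hcompA TrC hcompA etaE fmap_comp -hcompA.
  by rewrite [RHS]TrC.
- move=> x x' k; apply: Tr_inj => h.
  rewrite [in LHS]hcompA [LHS]TrC [in LHS]hcompA epsE [in RHS]hcompA epsE.
  rewrite !fmap_comp [in LHS]hcompA adj_counit_nat -[in LHS]hcompA [LHS]TrC.
  by rewrite -hcompA.
- move=> y; apply: Tr_inj => h.
  rewrite [in LHS]hcompA [LHS]TrC [in LHS]hcompA epsE fmap_comp.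
  rewrite [in LHS]hcompA adj_counit_nat -[in LHS]hcompA [LHS]TrC etaE fmap_comp.
  by rewrite -[in LHS]hcompA -adj_unit_nat hcompA adj_zag hcomp_id_l hcomp_id_r.
- move=> x; apply: Tr_inj => f.
  by rewrite etaT epsE fmap_comp hcompA adj_counit_nat -hcompA adj_zig hcomp_id_r.
by exists b => x y f g; rewrite bu etaT.
Qed.
End Pair.

Definition transpose (A B : two_hilbert C) (F : star_functor A B)
    (U : star_functor B A) (a : F ⊣ U) : U ⊣ F :=
  sval (cid (transposed_exists a)).

Lemma transposeP (A B : two_hilbert C) (F : star_functor A B)
    (U : star_functor B A) (a : F ⊣ U) : transposed a (transpose a).
Proof. exact: svalP (cid (transposed_exists a)). Qed.

Lemma adj_comp_unitE (A B D : two_hilbert C) (F : star_functor A B)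
    (U : star_functor B A) (G : star_functor B D) (V : star_functor D B)
    (a : F ⊣ U) (b : G ⊣ V) (x : A) :
  adj_unit (adj_comp a b : comp_functor G F ⊣ comp_functor U V) x
    = fmap U (adj_unit b (F x)) \h adj_unit a x.
Proof. by rewrite /= !hcomp_id_l hcomp_id_r. Qed.

(** Two applications of the hypotheses: the adjunction isomorphism of the
    composite is the composite of the two adjunction isomorphisms. *)
Lemma transposed_comp (A B D : two_hilbert C) (F : star_functor A B)
    (U : star_functor B A) (G : star_functor B D) (V : star_functor D B)
    (a : F ⊣ U) (b : G ⊣ V) (a' : U ⊣ F) (b' : V ⊣ G) :
  transposed a a' -> transposed b b' ->
  @transposed A D (comp_functor G F) (comp_functor U V)
    (adj_comp a b) (adj_comp b' a').
Proof.
move=> ta tb x z f g; rewrite !adj_comp_unitE.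
have := tb (F x) z f (fmap F g \h adj_unit a' (V z)).
by rewrite ta /= !fmap_comp -!hcompA.
Qed.

Lemma transposed_id (A : two_hilbert C) :
  @transposed A A (id_functor A) (id_functor A) (adj_id (K := TwoHilb C) A)
    (adj_id (K := TwoHilb C) A).
Proof. by move=> x y f g /=; rewrite !hcomp_id_r. Qed.

Lemma right_mateE (A B : two_hilbert C) (F G : star_functor A B)
    (U V : star_functor B A) (a : F ⊣ U) (b : G ⊣ V) (theta : nat_trans F G)
    (y : B) :
  (right_mate a b theta : nat_trans V U) y =
  fmap U (adj_counit b y \h theta (V y)) \h adj_unit a (V y).
Proof. by rewrite /= !hcomp_id_l hcomp_id_r fmap_comp hcompA. Qed.

Lemma left_mateE (A B : two_hilbert C) (F G : star_functor A B)
    (U V : star_functor B A) (a : U ⊣ F) (b : V ⊣ G) (theta : nat_trans F G)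
    (y : B) :
  (left_mate a b theta : nat_trans V U) y =
  adj_counit b (U y) \h fmap V (theta (U y) \h adj_unit a y).
Proof. by rewrite /= !hcomp_id_l hcomp_id_r fmap_comp. Qed.

(** The transposition relation between the inverses of the adjunction
    isomorphisms. *)
Lemma transposed_counit (A B : two_hilbert C) (F : star_functor A B)
    (U : star_functor B A) (a : F ⊣ U) (b : U ⊣ F) (x : A) (y : B)
    (f : hhom y (F x)) (h : hhom x (U y)) :
  transposed a b ->
  Tr ((adj_counit b x \h fmap U f) \h h) = Tr (f \h (adj_counit a y \h fmap F h)).
Proof.
move=> t; have := t _ _ (adj_counit a y \h fmap F h) (adj_counit b x \h fmap U f).
by rewrite !adj_homK TrC => <-; rewrite TrC.
Qed.

(** Paired with [g : U y -> V y], the right mate has trace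
    [Tr (epsG theta F(g) eta)], with [epsG] the counit of [b] and [eta] the unit
    of [a']; the left mate has trace [Tr (theta eta epsG G(g))].  These agree by
    naturality of [theta] and cyclicity. *)
Lemma transposed_mates (A B : two_hilbert C) (F G : star_functor A B)
    (U V : star_functor B A) (a : F ⊣ U) (b : G ⊣ V) (a' : U ⊣ F) (b' : V ⊣ G)
    (theta : nat_trans F G) :
  transposed a a' -> transposed b b' ->
  right_mate (K := TwoHilb C) a b theta = left_mate (K := TwoHilb C) a' b' theta.
Proof.
move=> ta tb; apply: nat_transP => y; apply: Tr_inj => g.
rewrite right_mateE left_mateE [LHS]TrC [RHS]TrC -ta (transposed_counit _ _ tb).
by rewrite [RHS]TrC -!hcompA (hcompA (theta _)) nt_nat -!hcompA.
Qed.
End Transposition.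

(** * Orthonormal bases and eigenvectors *)

Section OrthonormalBases.
Variables (C : numClosedFieldType) (V : hilbert C).

Definition orthonormal_fam n (e : 'I_n -> V) : Prop :=
  forall i j, ip (e i) (e j) = (i == j)%:R.

Definition spans n (e : 'I_n -> V) (v : V) : Prop :=
  v = \sum_i ip (e i) v *: e i.

Lemma orthonormal_sum n (e : 'I_n -> V) (c : 'I_n -> C) i :
  orthonormal_fam e -> ip (e i) (\sum_j c j *: e j) = c i.
Proof.
move=> oe; rewrite ip_sumr (bigD1 i) //= ipZr oe eqxx mulr1.
rewrite big1 ?addr0 // => j ji.
by rewrite ipZr oe eq_sym (negbTE ji) mulr0.
Qed.

Lemma parseval n (e : 'I_n -> V) (c c' : 'I_n -> C) :
  orthonormal_fam e ->
  ip (\sum_i c i *: e i) (\sum_i c' i *: e i) = \sum_i (c i)^* * c' i.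
Proof.
move=> oe; rewrite ip_suml; apply: eq_bigr => i _.
by rewrite ipZl orthonormal_sum.
Qed.

(** A vector outside the span of a shorter family, minus its projection to this
    span and normalised, extends the family. *)
Lemma gram_schmidt (U : {vspace V}) n : (n <= \dim U)%N ->
  exists e : 'I_n -> V, (forall i, e i \in U) /\ orthonormal_fam e.
Proof.
elim: n => [_|n IH ltn]; first by exists (fun=> 0); split=> [][].
have [e [eU oe]] := IH (ltnW ltn).
have /subvPn[v vU vX] : ~~ (U <= <<[tuple e i | i < n]>>)%VS.
  apply: contraL ltn => /dimvS le; rewrite -leqNgt.
  by apply: (leq_trans le); rewrite (leq_trans (dim_span _)) ?size_tuple.
pose w := v - \sum_i ip (e i) v *: e i.
have eX i : e i \in <<[tuple e i | i < n]>>%VS.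
  by apply: memv_span; rewrite -(tnth_mktuple e i) mem_tnth.
have w0 : w != 0.
  apply: contraNneq vX => /eqP; rewrite subr_eq0 => /eqP ->.
  by apply: memv_suml => i _; apply: memvZ.
have wU : w \in U by apply: memvB => //; apply: memv_suml => i _; apply: memvZ.
have ew i : ip (e i) w = 0.
  by rewrite ipBr orthonormal_sum // subrr.
pose u := (sqrtC (ip w w))^-1 *: w.
have uu : ip u u = 1.
  rewrite ipZl ipZr geC0_conj ?invr_ge0 ?sqrtC_ge0 ?ip_ge0 //.
  by rewrite mulrA -invfM -expr2 sqrtCK mulVf // ip_eq0.
have eu i : ip (e i) u = 0 by rewrite ipZr ew mulr0.
exists (fun i => if unlift ord_max i is Some j then e j else u); split=> [i|i j].
  by case: unliftP => [j _|_] //; apply: memvZ.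
case: unliftP => [i' ->|->]; case: unliftP => [j' ->|->].
- by rewrite oe (inj_eq lift_inj).
- by rewrite eu eq_sym (negbTE (neq_lift _ _)).
- by rewrite ipC eu rmorph0 (negbTE (neq_lift _ _)).
- by rewrite uu eqxx.
Qed.

Lemma orthonormal_basis (U : {vspace V}) n : \dim U = n ->
  exists e : 'I_n -> V, [/\ forall i, e i \in U, orthonormal_fam e &
    forall v, v \in U -> spans e v].
Proof.
move=> dU; have [|e [eU oe]] := @gram_schmidt U n; first by rewrite dU.
exists e; split=> // v vU; pose X := [tuple e i | i < n].
have fX : free X.
  apply/freeP => k k0 i; rewrite -(orthonormal_sum k i oe).
  have -> : \sum_j k j *: e j = 0; last by rewrite ip0r.
  rewrite -[RHS]k0; apply: eq_bigr => j _.
  by rewrite -tnth_nth tnth_mktuple.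
have bX : basis_of U X.
  rewrite basisEfree fX size_tuple dU leqnn andbT /=.
  by apply/span_subvP => _ /mapP[i _ ->].
have vE : v = \sum_i coord X i v *: e i.
  rewrite {1}(coord_basis bX vU).
  by apply: eq_bigr => j _; rewrite -tnth_nth tnth_mktuple.
rewrite /spans {1}vE; apply: eq_bigr => i _; congr (_ *: _).
by rewrite [in RHS]vE orthonormal_sum.
Qed.
End OrthonormalBases.

(** A linear map of vector spaces is conjugated to a matrix by coordinates,
    and a matrix over an algebraically closed field has an eigenvalue. *)
Lemma exists_eigenvector (C : numClosedFieldType) (V : vectType C)
    (T : 'End(V)) (v : V) :
  v != 0 -> exists (c : C) (w : V), w != 0 /\ T w = c *: w.
Proof.
move=> v0; have n0 : (0 < dim V)%N.
  rewrite -dimvf lt0n dimv_eq0; apply: contraNneq v0 => e.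
  by rewrite -memv0 -e memvf.
pose T' : 'rV_(dim V) -> 'rV_(dim V) := fun r => v2r (T (r2v r)).
have lT : linear T' by move=> a p q; rewrite /T' !linearP.
pose i := GRing.isLinear.Build _ _ _ _ T' lT.
pose L : {linear 'rV_(dim V) -> 'rV_(dim V)} := HB.pack T' i.
have [c /eigenvalueP[r rE r0]] := eigenvalue_closed (lin1_mx L) n0.
exists c, (r2v r); split; last first.
  by apply: v2r_inj; rewrite linearZ /= r2vK -rE mul_rV_lin1.
by apply: contraNneq r0 => e; rewrite -(r2vK r) e linear0.
Qed.

(** * Semisimplicity *)

Section Semisimplicity.
Variables (C : numClosedFieldType) (H : hcat C).
Implicit Types x y z s t : H.

(** The right ideal of all [f] with [g f = 0] is generated by an idempotent, as in
    a finite-dimensional C-star algebra.  The idempotent is the orthogonal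
    projection [p] of the identity to the ideal.  As [f h] lies in the ideal when
    [f] does, [id - p] is orthogonal to every [f h], whence [f* (id - p) = 0].
    So [f = p* f] for all [f] in the ideal, and [f = p] gives [p = p* p], which
    is self-adjoint. *)
Lemma ideal_projection x y (g : hhom x y) : exists e : hhom x x,
  [/\ e \h e = e, g \h e = 0 & forall f : hhom x x, g \h f = 0 -> e \h f = f].
Proof.
have [L LE] := lfun_of_linear (@hcomp_linear_r C H x x y g).
have memL f : (f \in lker L) = (g \h f == 0) by rewrite memv_ker LE.
have [e [eU oe sp]] := @orthonormal_basis C (hhom x x) (lker L) _ erefl.
pose p := \sum_i ip (e i) (hid x) *: e i.
have pU : p \in lker L by apply: memv_suml => i _; apply: memvZ.
have orth f : f \in lker L -> ip f (hid x - p) = 0.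
  move=> /sp ->; rewrite ip_suml big1 // => i _.
  by rewrite ipZl ipBr orthonormal_sum // subrr mulr0.
have absorb (f : hhom x x) : g \h f = 0 -> hstar p \h f = f.
  move=> gf; apply: hstar_inj; rewrite hstar_comp hstarK.
  suff : hstar f \h (hid x - p) = 0.
    by rewrite hcompBr hcomp_id_r => /eqP; rewrite subr_eq0 => /eqP.
  apply: ip_injr => h; rewrite ip0r ip_comp_adj hstarK; apply: orth.
  by rewrite memL hcompA gf hcomp0l.
have gp : g \h p = 0 by apply/eqP; rewrite -memL.
have ps : hstar p = p.
  by rewrite -{1}(absorb _ gp) hstar_comp hstarK (absorb _ gp).
by rewrite ps in absorb; exists p; split=> //; apply: absorb.
Qed.

(** When idempotents split this is equivalent to simplicity, by Schur's lemma; it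
    is the form that yields scalars directly. *)
Definition atom x : Prop :=
  hid x <> 0 /\ forall f : hhom x x, exists c, f = c *: hid x.

(** A non-scalar [f] has an eigenvalue [c] for left multiplication on the
    endomorphisms of [x], so [f - c id] annihilates a nonzero right ideal, which
    is proper because [f - c id] is nonzero. *)
Lemma nontrivial_idempotent x : hid x <> 0 -> ~ atom x ->
  exists e : hhom x x, [/\ e \h e = e, e <> 0 & e <> hid x].
Proof.
move=> x0 nax.
have /existsNP[f nf] : ~ forall f : hhom x x, exists c, f = c *: hid x.
  by move=> sc; apply: nax.
have [L LE] := lfun_of_linear (@hcomp_linear_r C H x x x f).
have [c [v [v0 vE]]] := exists_eigenvector L (introN eqP x0).
rewrite LE in vE; pose g := f - c *: hid x.
have gv : g \h v = 0 by rewrite hcompBl vE hcompZl hcomp_id_l subrr.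
have [e [ee ge ev]] := ideal_projection g.
exists e; split=> // [e0|e1].
  by move/eqP: v0; apply; rewrite -(ev _ gv) e0 hcomp0l.
apply: nf; exists c; apply/eqP; rewrite -subr_eq0 -/g.
by rewrite -[g]hcomp_id_r -e1 ge.
Qed.

(** Transport along the splitting embeds the endomorphisms of [y] in those of
    [x], and the identity of [x] is not in the image.  This is what makes the
    induction of [atoms_separate] terminate. *)
Lemma split_dim x y (r : hhom x y) (m : hhom y x) :
  r \h m = hid y -> m \h r <> hid x ->
  (\dim {: hhom y y} < \dim {: hhom x x})%N.
Proof.
move=> rm mr.
have lphi : linear (fun h : hhom y y => m \h h \h r).
  by move=> a h h'; rewrite hcomp_linear_r hcomp_linear_l.
have [L LE] := lfun_of_linear lphi.
have kL : lker L == 0%VS.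
  apply/lker0P => h h'; rewrite !LE => /(congr1 (fun k => r \h k \h m)).
  by rewrite !hcompA rm !hcomp_id_l -!hcompA rm !hcomp_id_r.
have <- : \dim (limg L) = \dim {: hhom y y}.
  by apply: limg_dim_eq; rewrite (eqP kL) capv0.
rewrite ltn_neqAle dimvS ?subvf // andbT; apply/negP => /eqP e.
have /eqP lE : limg L == fullv by rewrite eqEdim subvf e leqnn.
have /memv_imgP[h _ hE] : hid x \in limg L by rewrite lE memvf.
rewrite LE in hE; apply: mr; rewrite -[LHS]hcomp_id_r {1}hE.
by rewrite !hcompA -(hcompA m) rm hcomp_id_r -hE.
Qed.

Hypothesis splitting : idempotents_split H.

(** This form of semisimplicity replaces the decomposition into simple
    summands.  If [x] is neither zero nor an atom, a nontrivial idempotent [e]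
    and [id - e] split through objects with smaller endomorphism algebras, on both
    of which [d] vanishes by induction. *)
Lemma atoms_separate x z (d : hhom x z) :
  (forall s (f : hhom s x), atom s -> d \h f = 0) -> d = 0.
Proof.
move: {2}(\dim {: hhom x x}) (leqnn (\dim {: hhom x x})) => n.
elim: n x d => [|n IH] x d le dP.
  suff e : hid x = 0 by rewrite -[d]hcomp_id_r e hcomp0r.
  apply/eqP; rewrite -memv0; move: le; rewrite leqn0 dimv_eq0 => /eqP <-.
  exact: memvf.
have [e|x0] := pselect (hid x = 0); first by rewrite -[d]hcomp_id_r e hcomp0r.
have [ax|nax] := pselect (atom x); first by rewrite -[d]hcomp_id_r dP.
have [e [ee e0 e1]] := nontrivial_idempotent x0 nax.
have part (p : hhom x x) : p \h p = p -> p <> hid x -> d \h p = 0.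
  move=> pp p1; have [y [r [m [mr rm]]]] := splitting pp.
  rewrite -mr hcompA (IH y (d \h m)) ?hcomp0l //.
    by rewrite -ltnS (leq_trans (split_dim rm _)) // mr.
  by move=> s f sP; rewrite -hcompA dP.
rewrite -[d]hcomp_id_r -[hid x](subrK e) hcompDr (part e) // part ?addr0 //.
  by rewrite hcompBl !hcompBr !hcomp_id_l hcomp_id_r ee subrr subr0.
by move=> /eqP; rewrite subr_eq addrC -subr_eq subrr eq_sym => /eqP.
Qed.

Lemma hstar_comp_eq0 x y (f : hhom x y) : hstar f \h f = 0 -> f = 0.
Proof.
by move=> e; apply/eqP; rewrite -ip_eq0 -{1}[f]hcomp_id_r ip_star_l e ip0r.
Qed.

(** For a monomorphism [m] into an atom, [m m*] is a scalar, and it is nonzero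
    unless [m = 0]; dividing by it makes [m*] a two-sided inverse of [m]. *)
Lemma atom_simple s : atom s -> hsimple s.
Proof.
move=> [s0 sc]; split=> // y m mono; have [|m0] := pselect (m = 0); first by left.
right; have [c cE] := sc (m \h hstar m).
have c0 : c != 0.
  apply/eqP => c0; apply: m0; apply: hstar_inj; rewrite hstar0.
  by apply: hstar_comp_eq0; rewrite hstarK cE c0 scale0r.
have mn : m \h (c^-1 *: hstar m) = hid s.
  by rewrite hcompZr cE scalerA mulVf // scale1r.
exists (c^-1 *: hstar m); split=> //; apply: mono.
by rewrite hcompA mn hcomp_id_l hcomp_id_r.
Qed.

Lemma atom_iso s t : hiso s t -> atom s -> atom t.
Proof.
move=> [f [g [gf fg]]] [s0 sc]; split=> [t0|h].
  by apply: s0; rewrite -gf -[f]hcomp_id_l t0 hcomp0l hcomp0r.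
have [c cE] := sc (g \h h \h f); exists c.
have := congr1 (fun k => f \h k \h g) cE.
rewrite !hcompA fg hcomp_id_l -!hcompA fg hcomp_id_r => ->.
by rewrite hcompA hcompZr hcomp_id_r hcompZl fg.
Qed.

(** Schur's lemma: [f* f = c id] and [f f* = c' id], and comparing [f f* f]
    computed in the two ways gives [c = c'], so [f*] divided by [c] is inverse
    to [f]. *)
Lemma atom_hom_iso s t (f : hhom s t) : atom s -> atom t -> f <> 0 -> hiso s t.
Proof.
move=> [s0 sc] [t0 tc] f0; have [c cE] := sc (hstar f \h f).
have [c' cE'] := tc (f \h hstar f).
have c0 : c != 0.
  by apply/eqP => c0; apply/f0/hstar_comp_eq0; rewrite cE c0 scale0r.
have cc : c = c'.
  apply/eqP; rewrite -subr_eq0; apply/negP => /negP n0; apply: f0.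
  apply: (scalerI n0); rewrite scaler0 scalerBl; apply/eqP; rewrite subr_eq0.
  by rewrite -{1}[f]hcomp_id_r -hcompZr -cE hcompA cE' hcompZl hcomp_id_l.
exists f, (c^-1 *: hstar f); split.
  by rewrite hcompZl cE scalerA mulVf // scale1r.
by rewrite hcompZr cE' -cc scalerA mulVf // scale1r.
Qed.

Lemma hiso_sym s t : hiso s t -> hiso t s.
Proof. by move=> [f [g [a b]]]; exists g, f. Qed.

Lemma hiso_trans s t x : hiso s t -> hiso t x -> hiso s x.
Proof.
move=> [f [g [gf fg]]] [h [k [kh hk]]]; exists (h \h f), (g \h k).
split; first by rewrite hcompA -(hcompA g) kh hcomp_id_r.
by rewrite hcompA -(hcompA h) fg hcomp_id_r.
Qed.

Definition atom_reps (I : finType) (s : I -> H) : Prop :=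
  [/\ forall i, atom (s i),
      forall i j, i != j -> forall f : hhom (s i) (s j), f = 0
    & forall x, atom x -> exists i, hiso (s i) x].

(** The given list of representatives may contain objects that are not simple and
    repetitions up to isomorphism; keeping an atom only at its first occurrence
    removes both. *)
Lemma exists_atom_reps : finitely_many_simples H ->
  exists (I : finType) (s : I -> H), atom_reps s.
Proof.
move=> [n [s sP]].
pose good (i : 'I_n) :=
  `[< atom (s i) /\ forall j : 'I_n, (j < i)%N -> ~ hiso (s j) (s i) >].
exists {i | good i}, (fun i => s (val i)); split=> [[i gi]|[i gi] [j gj]|x ax].
- by have /asboolP[] := gi.
- rewrite -val_eqE /= => ij f; apply: contrapT => f0.
  have /asboolP[ai mi] := gi; have /asboolP[aj mj] := gj.
  have iso := atom_hom_iso ai aj f0.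
  case: (ltngtP i j) => [/mj|/mi|/val_inj e]; first exact.
    by apply; apply: hiso_sym.
  by rewrite e eqxx in ij.
have [i0 i0P] := sP x (atom_simple ax).
pose P k := `[< exists2 i : 'I_n, i = k :> nat & hiso x (s i) >].
have exP : exists k, P k by exists i0; apply/asboolP; exists i0.
have [k /asboolP[i ik iso] kmin] := find_ex_minn exP.
have gi : good i.
  apply/asboolP; split; first exact: atom_iso iso ax.
  move=> j ji jiso; have : (k <= j)%N; last by rewrite leqNgt -ik ji.
  apply: kmin; apply/asboolP; exists j => //.
  exact: hiso_trans iso (hiso_sym jiso).
by exists (Sub i gi); apply: hiso_sym.
Qed.
End Semisimplicity.

(** * Objects with prescribed multiplicities *)

Section DirectSums.
Variables (C : numClosedFieldType) (H : hcat C).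

(** Reindexes a dependent family along the enumeration of a finite type, so that
    the casts this needs occur only here. *)
Lemma enum_val_family (T : finType) (P : T -> Type)
    (f : forall k : 'I_#|T|, P (enum_val k)) :
  exists f' : forall t, P t, forall k, f' (enum_val k) = f k.
Proof.
exists (fun t => eq_rect _ P (f (enum_rank t)) t (enum_rankK t)) => k.
move: (enum_rankK (enum_val k)); rewrite enum_valK => e.
by rewrite (Prop_irrelevance e erefl).
Qed.

Lemma finite_direct_sum (T : finType) (x : T -> H) : has_direct_sums H ->
  exists (z : H) (i : forall t, hhom (x t) z) (p : forall t, hhom z (x t)),
    [/\ forall t, p t \h i t = hid (x t),
        forall t u, u != t -> p t \h i u = 0
      & \sum_t i t \h p t = hid z].
Proof.
move=> /(_ #|T| (fun k => x (enum_val k))) [z [i [p [pi pj ip1]]]].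
have [i' iE] := @enum_val_family T (fun t => hhom (x t) z) i.
have [p' pE] := @enum_val_family T (fun t => hhom z (x t)) p.
have ev t : exists k : 'I_#|T|, enum_val k = t.
  by exists (enum_rank t); rewrite enum_rankK.
exists z, i', p'; split=> [t|t u|].
- by have [k <-] := ev t; rewrite iE pE.
- have [k <-] := ev t; have [j <-] := ev u => kj.
  by rewrite iE pE pj //; apply: contraNneq kj => ->.
rewrite -ip1 (reindex (fun k : 'I_#|T| => enum_val k)) /=.
  by apply: eq_bigr => k _; rewrite iE pE.
by apply: onW_bij; apply: enum_val_bij.
Qed.
End DirectSums.

Section Multiplicities.
Variables (C : numClosedFieldType) (H : hcat C).
Variables (I : finType) (s : I -> H).
Hypothesis reps : atom_reps s.

(** The direct sum of [d i] copies of each [s i]: a morphism from [s a] into it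
    has zero components at the other representatives and scalar components at the
    copies of [s a], so the inclusions of these copies form a basis. *)
Lemma exists_multiplicities (d : I -> nat) : has_direct_sums H ->
  exists u : H, forall i, \dim {: hhom (s i) u} = d i.
Proof.
have [atoms inequiv _] := reps; move=> sums.
have [z [i [p [pi pj ip1]]]] :=
  @finite_direct_sum C H {a : I & 'I_(d a)} (fun t => s (tag t)) sums.
exists z => a.
pose inj (l : 'I_(d a)) : hhom (s a) z := i (Tagged (fun b => 'I_(d b)) l).
pose prj (l : 'I_(d a)) : hhom z (s a) := p (Tagged (fun b => 'I_(d b)) l).
have prj_inj l l' : prj l \h inj l' = (l == l')%:R *: hid (s a).
  have [->|ll] := eqVneq l l'.
    by rewrite scale1r; exact: (pi (Tagged (fun b => 'I_(d b)) l')).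
  rewrite scale0r; refine (pj (Tagged _ l) (Tagged (fun b => 'I_(d b)) l') _).
  by rewrite eq_Tagged eq_sym.
have [s0 sc] := atoms a.
pose X := [tuple inj l | l < d a].
have XE (l : 'I_(d a)) : X`_l = inj l by rewrite -tnth_nth tnth_mktuple.
suff /size_basis : basis_of fullv X by [].
apply/andP; split; last first.
  apply/freeP => k k0 l.
  have := congr1 (fun h => prj l \h h) k0; rewrite hcomp0r hcomp_sumr.
  rewrite (bigD1 l) //= XE hcompZr prj_inj eqxx scale1r big1 => [|l' ll].
    by rewrite addr0 => /eqP; rewrite scaler_eq0 => /orP[/eqP//|/eqP].
  by rewrite XE hcompZr prj_inj eq_sym (negbTE ll) scale0r scaler0.
rewrite eqEsubv subvf; apply/subvP => f _.
rewrite -[f]hcomp_id_l -ip1 hcomp_suml; apply: memv_suml => -[b l] _.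
have [ba|ba] := eqVneq a b; last first.
  have pf0 := inequiv _ _ ba (p (Tagged (fun b => 'I_(d b)) l) \h f).
  by rewrite -hcompA pf0 hcomp0r mem0v.
subst b; have [c cE] := sc (prj l \h f).
rewrite -hcompA -/(prj l) cE hcompZr; apply: memvZ; rewrite hcomp_id_r.
by apply: memv_span; rewrite -/(inj l) -(tnth_mktuple inj l) mem_tnth.
Qed.

(** The inner product of [Hom(s i, x)] is this multiple of the scalar by which
    [f* g] acts on [s i]; the structure does not force it to be 1. *)
Definition weight i : C := ip (hid (s i)) (hid (s i)).

Lemma weight_neq0 i : weight i != 0.
Proof. by rewrite ip_eq0; apply/eqP; have [/(_ i)[]] := reps. Qed.

Lemma hstar_comp_atom x i (f g : hhom (s i) x) :
  hstar f \h g = (ip f g / weight i) *: hid (s i).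
Proof.
have [/(_ i)[_ /(_ (hstar f \h g)) [c cE]] _ _] := reps.
rewrite cE; congr (_ *: _); apply: (mulIf (weight_neq0 i)).
rewrite divfK ?weight_neq0 //.
by rewrite -[f in RHS]hcomp_id_r ip_star_l cE ipZr.
Qed.

Variables (x : H) (n : I -> nat) (e : forall i, 'I_(n i) -> hhom (s i) x).
Hypothesis se : forall i f, spans (@e i) f.

(** By [atoms_separate] it is enough to compare the two sides on morphisms
    [f : s i -> x], where the right-hand side gives the expansion of [f] in the
    basis [e i]. *)
Lemma resolution : idempotents_split H ->
  hid x = \sum_i \sum_(k < n i) weight i *: (e k \h hstar (e k)).
Proof.
move=> splitting; have [_ inequiv complete] := reps.
apply/eqP; rewrite -subr_eq0; apply/eqP; apply: (atoms_separate splitting).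
have base i (f : hhom (s i) x) :
    (\sum_i \sum_(k < n i) weight i *: (e k \h hstar (e k))) \h f = f.
  rewrite hcomp_suml (bigD1 i) //= [X in _ + X]big1 ?addr0 => [|j ji].
    rewrite hcomp_suml [RHS]se; apply: eq_bigr => k _.
    rewrite hcompZl -hcompA hstar_comp_atom hcompZr scalerA hcomp_id_r.
    by rewrite mulrC divfK ?weight_neq0.
  rewrite eq_sym in ji; rewrite hcomp_suml big1 // => k _.
  by rewrite hcompZl -hcompA (inequiv _ _ ji (_ \h f)) hcomp0r scaler0.
move=> t f atom_t; have [i [g [h [_ gh]]]] := complete _ atom_t.
rewrite -[f]hcomp_id_r -gh (hcompA f) hcompA.
by rewrite hcompBl hcomp_id_l base subrr hcomp0l.
Qed.
End Multiplicities.

(** * Existence of right adjoints *)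

Section Representability.
Variables (C : numClosedFieldType) (A B : two_hilbert C) (F : star_functor A B).

(** [eps] represents [x |-> Hom(F x, y)] by unitary bijections; injectivity
    follows from preservation of the inner product. *)
Definition unitary_rep (y : B) (u : A) (eps : hhom (F u) y) : Prop :=
  (forall (x : A) (h : hhom (F x) y), exists f : hhom x u, eps \h fmap F f = h) /\
  (forall (x : A) (f g : hhom x u),
     ip (eps \h fmap F f) (eps \h fmap F g) = ip f g).

(** [eps] is built to send an orthonormal basis [e i] of [Hom(s i, u)] to an
    orthonormal basis [g i] of [Hom(F (s i), y)].  For a general [x], both
    surjectivity and unitarity are reduced to the [s i] by inserting the
    resolution of the identity of [x]. *)
Lemma exists_unitary_rep (y : B) :
  exists (u : A) (eps : hhom (F u) y), unitary_rep eps.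
Proof.
have [sums splitting] := two_hilbert_cauchy A.
have [I [s reps]] := exists_atom_reps (two_hilbert_fd A).
have basis (D : two_hilbert C) (X : I -> D) (z : D) n :
    (forall i, \dim {: hhom (X i) z} = n i) ->
    exists e : forall i, 'I_(n i) -> hhom (X i) z,
      forall i, orthonormal_fam (e i) /\ forall f, spans (e i) f.
  move=> dimn.
  have ex i : exists e : 'I_(n i) -> hhom (X i) z,
      orthonormal_fam e /\ forall f, spans e f.
    have [e [_ oe sp]] := orthonormal_basis (dimn i).
    by exists e; split=> // f; apply/sp/memvf.
  by exists (fun i => sval (cid (ex i))) => i; apply: (svalP (cid (ex i))).
pose n i := \dim {: hhom (F (s i)) y}.
have [u un] := exists_multiplicities reps n sums.
have [e eP] := basis _ _ _ _ un.
have [g gP] := basis _ (fun i => F (s i)) y n (fun=> erefl).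
have oe i := (eP i).1; have og i := (gP i).1.
(* [weight s i] compensates for the scalar inverse to it by which the star of
   [e i k] composed with [e i k] acts on [s i] *)
pose eps := \sum_i \sum_k weight s i *: (g i k \h fmap F (hstar (e i k))).
have epsE i f : eps \h fmap F f = \sum_k ip (e i k) f *: g i k.
  rewrite hcomp_suml (bigD1 i) //= [X in _ + X]big1 ?addr0 => [|j ji].
    rewrite hcomp_suml; apply: eq_bigr => k _.
    rewrite hcompZl -hcompA -fmap_comp (hstar_comp_atom reps) fmapZ fmap_id.
    by rewrite hcompZr hcomp_id_r scalerA mulrC divfK ?weight_neq0.
  rewrite eq_sym in ji; rewrite hcomp_suml big1 // => k _.
  have [_ inequiv _] := reps.
  rewrite hcompZl -hcompA -fmap_comp (inequiv _ _ ji (_ \h f)) fmap0.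
  by rewrite hcomp0r scaler0.
exists u, eps; split=> x.
  have [b bP] := basis _ s x _ (fun=> erefl).
  move=> h; pose c i k l := ip (g i l) (h \h fmap F (b i k)).
  pose f i k := \sum_l c i k l *: e i l.
  exists (\sum_i \sum_k weight s i *: (f i k \h hstar (b i k))).
  rewrite -[RHS]hcomp_id_r -fmap_id.
  rewrite (resolution reps (fun i => (bP i).2) splitting).
  rewrite !fmap_sum !hcomp_sumr; apply: eq_bigr => i _.
  rewrite !fmap_sum !hcomp_sumr; apply: eq_bigr => k _.
  rewrite !fmapZ !hcompZr !fmap_comp !hcompA; congr (_ *: (_ \h _)).
  rewrite epsE [RHS](gP i).2; apply: eq_bigr => l _.
  by rewrite orthonormal_sum.
have [b bP] := basis _ s x _ (fun=> erefl); move=> f f'.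
have isoS i (h h' : hhom (s i) u) :
    ip (eps \h fmap F h) (eps \h fmap F h') = ip h h'.
  rewrite !epsE parseval // [in RHS]((eP i).2 h) [in RHS]((eP i).2 h').
  by rewrite parseval.
have rx := resolution reps (fun i => (bP i).2) splitting.
rewrite -[f' in LHS]hcomp_id_r -[f' in RHS]hcomp_id_r rx.
rewrite !hcomp_sumr fmap_sum hcomp_sumr !ip_sumr.
apply: eq_bigr => i _; rewrite !hcomp_sumr fmap_sum hcomp_sumr !ip_sumr.
apply: eq_bigr => k _; rewrite !hcompZr fmapZ hcompZr !ipZr; congr (_ * _).
rewrite !hcompA !fmap_comp hcompA fmap_star.
by rewrite -!ip_star_r -!hcompA -!fmap_comp isoS.
Qed.
End Representability.

Section RightAdjoint.
Variables (C : numClosedFieldType) (A B : two_hilbert C) (F : star_functor A B).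

Let rep (y : B) : {u : A | exists eps : hhom (F u) y, unitary_rep eps} :=
  cid (exists_unitary_rep F y).
Let U y : A := sval (rep y).
Let counit y : hhom (F (U y)) y := sval (cid (svalP (rep y))).
Let counitP y : unitary_rep (counit y) := svalP (cid (svalP (rep y))).

Let lift x y (h : hhom (F x) y) : hhom x (U y) :=
  sval (cid ((counitP y).1 x h)).

Lemma counit_lift x y (h : hhom (F x) y) : counit y \h fmap F (lift h) = h.
Proof. exact: (svalP (cid ((counitP y).1 x h))). Qed.

Lemma counit_inj x y (f g : hhom x (U y)) :
  counit y \h fmap F f = counit y \h fmap F g -> f = g.
Proof.
move=> e; apply: ip_inj => w.
by rewrite -!(counitP y).2 e.
Qed.

Let Umap y y' (k : hhom y y') : hhom (U y) (U y') := lift (k \h counit y).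

Lemma counit_nat y y' (k : hhom y y') :
  counit y' \h fmap F (Umap k) = k \h counit y.
Proof. exact: counit_lift. Qed.

Lemma Umap_id y : Umap (hid y) = hid (U y).
Proof.
by apply: counit_inj; rewrite counit_nat fmap_id hcomp_id_l hcomp_id_r.
Qed.

Lemma Umap_comp x y z (f : hhom y z) (g : hhom x y) :
  Umap (f \h g) = Umap f \h Umap g.
Proof.
apply: counit_inj; rewrite counit_nat fmap_comp hcompA counit_nat.
by rewrite -[RHS]hcompA counit_nat hcompA.
Qed.

Lemma Umap_linear x y : linear (@Umap x y).
Proof.
move=> a f g; apply: counit_inj.
rewrite counit_nat fmap_linear hcomp_linear_r !counit_nat.
exact: hcomp_linear_l.
Qed.

(** This is where unitarity is needed: against any [w], both sides have inner
    product [(Umap f w, id)], the left one after transporting along the counit,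
    moving [f] across, and transporting back. *)
Lemma Umap_star x y (f : hhom x y) : Umap (hstar f) = hstar (Umap f).
Proof.
apply: ip_injr => w; rewrite -(counitP x).2 counit_nat.
rewrite ip_comp_adj hstarK hcompA -counit_nat -hcompA -fmap_comp.
rewrite -[counit y in X in ip _ X]hcomp_id_r -fmap_id (counitP y).2.
by rewrite -[hstar (Umap f)]hcomp_id_r ip_comp_adj hstarK.
Qed.

Definition right_adjoint : star_functor B A :=
  StarFunctor Umap_id Umap_comp Umap_linear Umap_star.

Lemma right_adjointP : inhabited (F ⊣ right_adjoint).
Proof.
have [||||a _] := @adj_of_families C A B F right_adjoint
  (fun x => lift (hid (F x))) counit.
- move=> x y f; apply: counit_inj; rewrite !fmap_comp !hcompA counit_lift.
  by rewrite counit_nat hcomp_id_l -hcompA counit_lift hcomp_id_r.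
- by move=> x y f; apply: counit_nat.
- by move=> x; apply: counit_lift.
- move=> y; apply: counit_inj.
  by rewrite fmap_comp hcompA counit_nat -hcompA counit_lift fmap_id.
by exists.
Qed.
End RightAdjoint.

(** * The even-handed structure *)

Lemma dual_mapE (C : numClosedFieldType) (V W : vectType C) (f : 'Hom(V, W))
    (l : dual W) : dual_map f l = (l \o f)%VF.
Proof.
have lin : linear (fun l : dual W => (l \o f)%VF : dual V).
  by move=> c k k'; rewrite comp_lfunDl comp_lfunZl.
pose i := GRing.isLinear.Build _ _ _ _ _ lin.
pose L : {linear dual W -> dual V} :=
  HB.pack (fun l : dual W => (l \o f)%VF : dual V) i.
exact: (lfunE L).
Qed.

Section Formulas.
Variables (C : numClosedFieldType) (A B : two_hilbert C).
Variables (F : star_functor A B) (U : star_functor B A).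
Variables (a : F ⊣ U) (b : U ⊣ F).
Hypothesis t : transposed a b.

Lemma transposed_trace (x : A) (y : B) :
  adj_hom b y x = trace_transpose (adj_hom a x y).
Proof.
apply/lfunP => g; rewrite /trace_transpose !comp_lfunE.
apply/(lker0P (trace_iso_inj _ _)).
rewrite limg_lfunVK ?trace_iso_surj ?memvf //.
apply/lfunP => f; rewrite trace_isoE adj_homE t -adj_homE.
by rewrite dual_mapE comp_lfunE trace_isoE.
Qed.

(** Under [Tr (f h) = (f*, h)] the transposition relation is the defining property
    of the Hilbert space adjoint, with a star on either side. *)
Lemma transposed_star (x : A) (y : B) (g : hhom (U y) x) :
  adj_hom b y x g = hstar (hilbert_adj (adj_hom a x y) (hstar g)).
Proof.
apply: Tr_inj => f; rewrite [RHS]TrC [RHS]TrE hstarK hilbert_adjP.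
by rewrite !adj_homE t TrC TrE.
Qed.
End Formulas.

Theorem proposition5p16 (R : realType) :
  ambidextrous_adjoints (TwoHilb R[i]) /\
  exists Psi : even_handed (TwoHilb R[i]),
    (forall (A B : two_hilbert R[i]) (F : star_functor A B)
        (F' : star_functor B A) (phi : @adjunction (TwoHilb R[i]) A B F F')
        (x : A) (y : B),
      adj_hom (eh_map Psi phi) y x = trace_transpose (adj_hom phi x y)) /\
    (forall (A B : two_hilbert R[i]) (F : star_functor A B)
        (F' : star_functor B A) (phi : @adjunction (TwoHilb R[i]) A B F F')
        (x : A) (y : B) (g : hhom (F' y) x),
      adj_hom (eh_map Psi phi) y x g =
      hstar (hilbert_adj (adj_hom phi x y) (hstar g))).
Proof.
split.
  split=> [A B F|A B F U [a]]; last by exists; apply: transpose a.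
  by exists (right_adjoint F); apply: right_adjointP.
unshelve eexists.
  apply: (@EvenHanded (TwoHilb R[i]) (@transpose R[i])).
  - move=> A B F U a; apply: transposed_uniq (transposeP _) _.
    exact/transposed_sym/transposeP.
  - move=> A B D F U G V a b; apply: transposed_uniq (transposeP _) _.
    by apply: transposed_comp; apply: transposeP.
  - by move=> A; apply: transposed_uniq (transposeP _) _; apply: transposed_id.
  - by move=> A B F G U V a b theta; apply: transposed_mates; apply: transposeP.
split=> A B F U a x y; first exact/transposed_trace/transposeP.
by move=> g; apply/transposed_star/transposeP.
Qed.
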